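(* For $i\in\{1,2\}$, $$s_1(z)_{(0)}\,\varsigma_i(w)=-D_w^{(i)}A_{1i}(z,w)+T\bigg(B_{1i}(z,w)+D_z^{(1)}\frac{M\,\varsigma_i(w)}{z-w}\bigg),$$ where $$A_{11}(z,w)=\tfrac{M}{z-w}I^a_{-2}(z)I^a_{-1}(w)|0\rangle^{\bm k},\qquad B_{11}(z,w)=\tfrac{M}{(z-w)^2}I^a_{-1}(z)I^a_{-1}(w)|0\rangle^{\bm k},$$ $$A_{12}(z,w)=\tfrac{M}{2(z-w)}t_{abc}I^a_{-2}(z)I^b_{-1}(w)I^c_{-1}(w)|0\rangle^{\bm k},\qquad B_{12}(z,w)=\tfrac{M}{2(z-w)^2}t_{abc}I^a_{-1}(z)I^b_{-1}(w)I^c_{-1}(w)|0\rangle^{\bm k}.$$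
   Context: Work over $\mathbb C$. Fix an integer $M\ge 3$ and let $(X|Y)=\operatorname{tr}(XY)$ on $\mathfrak{sl}_M$ (trace in the defining $M\times M$ representation). The affine algebra $\widehat{\mathfrak{sl}}_M=\mathfrak{sl}_M[t,t^{-1}]\oplus\mathbb C\mathsf k$ has $\mathsf k$ central and, with $a_n:=a\otimes t^n$, $[a_m,b_n]=[a,b]_{m+n}-n\,\delta_{m+n,0}(a|b)\mathsf k$. Fix $N\ge 1$, distinct points $z_1,\dots,z_N\in\mathbb C$, and $\bm k=(k_1,\dots,k_N)\in\mathbb C^N$ with $k_i\neq -M$ for all $i$. For $A\in\widehat{\mathfrak{sl}}_M$ let $A^{(i)}$ be its copy in the $i$-th summand of $\widehat{\mathfrak{sl}}_M^{\oplus N}$. Let $\mathbb V_0^{\bm k}$ be the $\widehat{\mathfrak{sl}}_M^{\oplus N}$-module induced from the one-dimensional module $\mathbb C|0\rangle^{\bm k}$ over $(\mathfrak{sl}_M[t]\oplus\mathbb C\mathsf k)^{\oplus N}$ on which $\mathsf k^{(i)}$ acts as $k_i$ and $a_n^{(i)}$ ($n\ge0$) acts as $0$. It is a vertex algebra (the tensor product of the vacuum Verma modules of levels $k_i$) with modes $X_{(n)}$, $Y(X,u)=\sum_{n\in\mathbb Z}X_{(n)}u^{-n-1}$, determined by $(a_{-1}^{(i)}|0\rangle^{\bm k})_{(n)}=a_n^{(i)}$, $Y(TX,u)=\partial_uY(X,u)$, and $Y(X_{(-1)}Y',u)=\,:\!Y(X,u)Y(Y',u)\!:$ (the usual normal ordered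 product). The translation operator $T$ is the linear map with $T|0\rangle^{\bm k}=0$ and $[T,a_n^{(i)}]=-n\,a_{n-1}^{(i)}$. For $A\in\widehat{\mathfrak{sl}}_M$ put $A(z):=\sum_{i=1}^N\frac{A^{(i)}}{z-z_i}$. Let $I^a=I_a$ be a basis of $\mathfrak{sl}_M$ with $(I_a|I_b)=\delta_{ab}$; repeated Lie algebra indices are summed. Let $t_{abc}:=\operatorname{tr}(I_aI_bI_c+I_bI_aI_c)$. Define $$\varsigma_1(z):=\tfrac12 I^a_{-1}(z)I^a_{-1}(z)|0\rangle^{\bm k},\qquad \varsigma_2(z):=\tfrac13t_{abc}I^a_{-1}(z)I^b_{-1}(z)I^c_{-1}(z)|0\rangle^{\bm k}.$$ Twist function: $\varphi(z):=\sum_{i=1}^N\frac{k_i}{z-z_i}$. Twisted derivative of degree $j$: $D_z^{(j)}:=\partial_z-\frac jM\varphi(z)$. Segal–Sugawara states: $\omega^{(i)}:=\frac1{2(k_i+M)}I^{a(i)}_{-1}I^{a(i)}_{-1}|0\rangle^{\bm k}$, and $\omega(z):=\sum_{i=1}^N\frac{\omega^{(i)}}{z-z_i}$. Finally $s_1(z):=\varsigma_1(z)+M\,D_z^{(1)}\omega(z)\in\mathbb V_0^{\bm k}$, depending rationally on $z$. *)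

(* Defs.v *)
From HB Require Import structures.
From mathcomp Require Import all_boot all_order all_algebra finmap.
From mathcomp Require Import boolp classical_sets functions cardinality fsbigop.
From mathcomp Require Import reals topology normedtype derive.
From mathcomp Require Import complex.

Set Implicit Arguments.
Unset Strict Implicit.
Unset Printing Implicit Defensive.

Import Order.TTheory GRing.Theory Num.Theory.
Import numFieldNormedType.Exports.

Local Open Scope classical_set_scope.
Local Open Scope ring_scope.

Section FinSupp.
Variables (K : nzRingType) (I : choiceType) (W : lmodType K).

Definition finsupp_pred : {pred I -> W} :=
  fun f => `[< finite_set [set i | f i <> 0] >].

Lemma finsupp_pred_submod : submod_closed finsupp_pred.
Proof.
split=> [|c f g /asboolP Ff /asboolP Fg]; apply/asboolP.
  by rewrite (_ : mkset _ = set0) //; apply/seteqP; split=> i //=.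
apply: (@sub_finite_set _ _ ([set i | f i <> 0] `|` [set i | g i <> 0])).
  move=> i /= h; have [fi|] := pselect (f i = 0); last by left.
  by right=> gi; apply: h; rewrite [LHS](_ : _ = c *: f i + g i)// fi gi
     scaler0 addr0.
by rewrite finite_setU.
Qed.

HB.instance Definition _ :=
  GRing.isSubmodClosed.Build K (I -> W) finsupp_pred finsupp_pred_submod.

Record finsupp := FinSupp
  { finsupp_val :> I -> W; _ : finsupp_val \in finsupp_pred }.

HB.instance Definition _ := [isSub for finsupp_val].
HB.instance Definition _ := [Choice of finsupp by <:].
HB.instance Definition _ := [SubChoice_isSubLmodule of finsupp by <:].

Lemma fsdelta_subproof (i : I) (a : W) :
  (fun j => if j == i then a else 0) \in finsupp_pred.
Proof.
apply/asboolP; apply: (@sub_finite_set _ _ [set i]) => //= j /=.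
by case: eqP.
Qed.
Definition fsdelta (i : I) (a : W) : finsupp := FinSupp (fsdelta_subproof i a).

Lemma finsuppP (f g : finsupp) : (forall i, f i = g i) -> f = g.
Proof. by move=> fg; apply/val_inj/funext. Qed.

Lemma finite_finsupp (f : finsupp) : finite_set [set i | f i <> 0].
Proof. by apply/asboolP; case: f. Qed.

Lemma finsuppE (c : K) (f g : finsupp) (i : I) :
  (c *: f + g) i = c *: f i + g i.
Proof. by []. Qed.

End FinSupp.

Lemma finsupp_ind (K : nzRingType) (I : choiceType)
    (P : finsupp I K^o -> Prop) :
  P 0 -> (forall c f g, P f -> P g -> P (c *: f + g)) ->
  (forall i, P (fsdelta i 1)) -> forall f, P f.
Proof.
move=> P0 PD Pd f.
pose S : {fset I} := fset_set [set i | f i <> 0].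
have -> : f = \sum_(i <- enum_fset S) (f i : K) *: fsdelta i (1 : K^o).
  apply: finsuppP => j.
  have ev (s : seq I) : (\sum_(i <- s) (f i : K) *: fsdelta i (1 : K^o)) j
      = \sum_(i <- s) f i * (j == i)%:R.
    elim: s => [|i s IH]; first by rewrite !big_nil.
    by rewrite !big_cons finsuppE IH /=; congr (_ + _); case: (j == i).
  rewrite ev; have [fj|fj] := pselect (f j = 0).
    rewrite fj big1_seq // => i /andP[_ iS].
    by case: eqP iS => [<-|]; rewrite ?mulr0 // fj mul0r.
  rewrite (bigD1_seq j) ?fset_uniq //=; last first.
    by rewrite in_fset_set ?inE //; exact: finite_finsupp.
  rewrite eqxx mulr1 big1 ?addr0 // => i /negPf.
  by rewrite eq_sym => ->; rewrite mulr0.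
by elim: (enum_fset S) => [|i s IH]; rewrite ?big_nil ?big_cons //; exact: PD.
Qed.

Section Sl.
Variables (C : fieldType) (M : nat).

Definition sl_space : {vspace 'M[C]_M} :=
  lker (linfun (@mxtrace C M : 'M[C]_M -> C^o)).
Definition sl := subvs_of sl_space.

HB.instance Definition _ := Vector.on sl.

Definition sl_br (x y : sl) : sl :=
  vsproj sl_space (vsval x *m vsval y - vsval y *m vsval x).

Definition trform (x y : sl) : C := \tr (vsval x *m vsval y).

Lemma mem_sl_space (A : 'M[C]_M) : (A \in sl_space) = (\tr A == 0).
Proof. by rewrite memv_ker lfunE. Qed.

Lemma sl_brE (x y : sl) :
  vsval (sl_br x y) = vsval x *m vsval y - vsval y *m vsval x.
Proof.
by rewrite vsprojK // mem_sl_space linearB /= mxtrace_mulC subrr.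
Qed.

Lemma sl_br0l (x : sl) : sl_br 0 x = 0.
Proof. by apply/val_inj; rewrite [LHS]sl_brE linear0 !(mul0mx, mulmx0) subrr. Qed.

Lemma sl_br0r (x : sl) : sl_br x 0 = 0.
Proof. by apply/val_inj; rewrite [LHS]sl_brE linear0 !(mul0mx, mulmx0) subrr. Qed.

Lemma trform0l (x : sl) : trform 0 x = 0.
Proof. by rewrite /trform linear0 mul0mx mxtrace0. Qed.

Lemma trform0r (x : sl) : trform x 0 = 0.
Proof. by rewrite /trform [vsval 0]linear0 mulmx0 mxtrace0. Qed.

End Sl.

Section Affine.
Variables (C : fieldType) (M : nat).
Local Notation sl := (sl C M).

(* f : loop stands for the sum over n of f n (x) t^n. *)
Definition loop := finsupp int sl.
HB.instance Definition _ := GRing.Lmodule.on loop.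

Lemma loop_br_subproof (f g : loop) :
  (fun n : int => \sum_(m \in [set: int]) sl_br (f m) (g (n - m)))
    \in @finsupp_pred C int sl.
Proof.
apply/asboolP.
have := finite_image2 +%R (finite_finsupp f) (finite_finsupp g).
apply: sub_finite_set => n /= nz.
apply: contrapT => nex; apply: nz; apply: fsbig1 => m _.
have [fm|fm] := pselect (f m = 0); first by rewrite fm sl_br0l.
have [gn|gn] := pselect (g (n - m) = 0); first by rewrite gn sl_br0r.
by case: nex; exists m => //; exists (n - m) => //; rewrite addrC subrK.
Qed.

Definition loop_br (f g : loop) : loop := FinSupp (loop_br_subproof f g).

Definition affine := (loop * C^o)%type.
HB.instance Definition _ := GRing.Lmodule.on affine.

Definition affine_br (x y : affine) : affine :=
  (loop_br x.1 y.1,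
   - \sum_(n \in [set: int]) n%:~R * trform (x.1 (- n)) (y.1 n)).

Definition mode (a : sl) (n : int) : affine := (fsdelta n a, 0).
Definition central : affine := (0, 1).

Lemma mode_br (a b : sl) (m n : int) :
  affine_br (mode a m) (mode b n) =
  mode (sl_br a b) (m + n)
    - (n%:~R * (m + n == 0)%:R * trform a b) *: central.
Proof.
set c := (_ * _ in RHS); rewrite /affine_br /mode; congr pair.
  transitivity (fsdelta (m + n) (sl_br a b) - c *: (0 : loop)) => //.
  rewrite scaler0 subr0; apply: finsuppP => j /=.
  rewrite -(@fsbig_widen _ _ _ _ [set m]) //=; last first.
    by move=> i [_ /= /eqP /negPf ->]; rewrite sl_br0l.
  rewrite fsbig_set1 eqxx subr_eq [n + m]addrC.
  by case: eqP; rewrite ?sl_br0r.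
transitivity (0 - c * 1) => //; rewrite mulr1 sub0r /c; congr (- _).
rewrite -(@fsbig_widen _ _ _ _ [set n]) //=; last first.
  move=> i [_ /= /eqP /negPf ->].
  by rewrite trform0r mulr0.
rewrite fsbig_set1 eqxx eq_sym -addr_eq0.
by case: eqP => _; rewrite ?mulr1 // mulr0 mul0r trform0l mulr0.
Qed.

Lemma central_br (x : affine) :
  affine_br central x = 0 /\ affine_br x central = 0.
Proof.
split; rewrite /affine_br; congr pair.
- by apply: finsuppP => n /=; apply: fsbig1 => m _; rewrite sl_br0l.
- rewrite fsbig1 ?oppr0 // => n _.
  by rewrite [X in trform X]/= trform0l mulr0.
- by apply: finsuppP => n /=; apply: fsbig1 => m _; rewrite sl_br0r.
- rewrite fsbig1 ?oppr0 // => n _.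
  by rewrite trform0r mulr0.
Qed.

Variable N : nat.

Definition affineN := {ffun 'I_N -> affine}.
HB.instance Definition _ := GRing.Lmodule.on affineN.

Definition affineN_br (x y : affineN) : affineN :=
  [ffun i => affine_br (x i) (y i)].

Definition copy (i : 'I_N) (A : affine) : affineN :=
  [ffun j => if j == i then A else 0].

(* The subalgebra (sl_M[t] + C k)^N. *)
Definition annihilation (x : affineN) : Prop :=
  forall (i : 'I_N) (n : int), n < 0 -> (x i).1 n = 0.

(* The character of (sl_M[t] + C k)^N by which it acts on the vacuum line. *)
Definition level_char (k : 'I_N -> C) (x : affineN) : C :=
  \sum_(i < N) k i * (x i).2.

End Affine.

Section Induced.
Variables (C : fieldType) (g : lmodType C) (br : g -> g -> g).
Variables (p : g -> Prop) (chi : g -> C).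

Definition word (u : seq g) : finsupp (seq g) C^o := fsdelta u 1.

(* Words modulo ind_rel_lin form the tensor algebra T(g); adding ind_rel_br
   gives U(g), and ind_rel_char divides by the left ideal generated by the
   x - chi x with x in p. The quotient is U(g) (x)_{U(p)} C_chi. *)
Inductive ind_rel : finsupp (seq g) C^o -> Prop :=
| ind_rel0 : ind_rel 0
| ind_relD c r s : ind_rel r -> ind_rel s -> ind_rel (c *: r + s)
| ind_rel_lin u v c x y :
    ind_rel (word (u ++ c *: x + y :: v)
             - (c *: word (u ++ x :: v) + word (u ++ y :: v)))
| ind_rel_br u v x y :
    ind_rel (word (u ++ [:: x, y & v]) - word (u ++ [:: y, x & v])
             - word (u ++ br x y :: v))
| ind_rel_char u x : p x -> ind_rel (word (rcons u x) - chi x *: word u).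

Definition ind_pred : {pred finsupp (seq g) C^o} := fun r => `[< ind_rel r >].

Lemma ind_pred_zmod : zmod_closed ind_pred.
Proof.
split=> [|r s /asboolP Rr /asboolP Rs]; apply/asboolP; first exact: ind_rel0.
by rewrite addrC -scaleN1r; apply: ind_relD.
Qed.

HB.instance Definition _ :=
  GRing.isZmodClosed.Build (finsupp (seq g) C^o) ind_pred ind_pred_zmod.

Definition ind := Quotient.quot ind_pred.
HB.instance Definition _ := GRing.Zmodule.on ind.

Local Open Scope quotient_scope.

Definition ind_pi (r : finsupp (seq g) C^o) : ind := \pi_(Quotient.quot ind_pred) r.

Lemma ind_eqP (r s : finsupp (seq g) C^o) :
  ind_rel (r - s) -> ind_pi r = ind_pi s.
Proof. by move=> H; apply/eqP; rewrite -[_ == _]Quotient.idealrBE; apply/asboolP. Qed.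

Lemma ind_eq_repr (r : finsupp (seq g) C^o) :
  ind_rel (repr (ind_pi r) - r).
Proof.
have : repr (ind_pi r) - r \in ind_pred by rewrite Quotient.idealrBE reprK.
by move/asboolP.
Qed.

Definition ind_scale (c : C) (v : ind) : ind := ind_pi (c *: repr v).

Lemma pi_ind_scale c r : ind_scale c (ind_pi r) = ind_pi (c *: r).
Proof.
apply: ind_eqP; rewrite -scalerBr -[_ *: _]addr0.
by apply: ind_relD (ind_rel0); exact: ind_eq_repr.
Qed.

Lemma ind_reprK (v : ind) : ind_pi (repr v) = v.
Proof. exact: reprK. Qed.

Lemma pi_indD r s : ind_pi (r + s) = ind_pi r + ind_pi s.
Proof. exact: (@Quotient.pi_add _ ind_pred). Qed.

Fact ind_scaleA a b v : ind_scale a (ind_scale b v) = ind_scale (a * b) v.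
Proof. by rewrite -[v]ind_reprK !pi_ind_scale scalerA. Qed.

Fact ind_scale1 : left_id 1 ind_scale.
Proof. by move=> v; rewrite -[v]ind_reprK !pi_ind_scale scale1r. Qed.

Fact ind_scaleDr : right_distributive ind_scale +%R.
Proof.
move=> a u v; rewrite -[u]ind_reprK -[v]ind_reprK.
by rewrite -pi_indD !pi_ind_scale -pi_indD scalerDr.
Qed.

Fact ind_scaleDl v : {morph ind_scale^~ v : a b / a + b}.
Proof.
by move=> a b /=; rewrite -[v]ind_reprK !pi_ind_scale -pi_indD scalerDl.
Qed.

HB.instance Definition _ := GRing.Zmodule_isLmodule.Build C ind
  ind_scaleA ind_scale1 ind_scaleDr ind_scaleDl.

Lemma pi_ind_lin c r s :
  ind_pi (c *: r + s) = c *: ind_pi r + ind_pi s :> ind.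
Proof. by rewrite pi_indD -pi_ind_scale. Qed.

Lemma prefix_subproof (x : g) (r : finsupp (seq g) C^o) :
  (fun w => if w is y :: u then if y == x then r u else 0 else 0)
    \in @finsupp_pred C (seq g) C^o.
Proof.
apply/asboolP; have := finite_image (cons x) (finite_finsupp r).
apply: sub_finite_set.
by case=> //= y u; case: eqP => // -> ru; exists u.
Qed.

Definition prefix (x : g) (r : finsupp (seq g) C^o) : finsupp (seq g) C^o :=
  FinSupp (prefix_subproof x r).

Definition act (x : g) (v : ind) : ind := ind_pi (prefix x (repr v)).

Definition vac : ind := ind_pi (word [::]).

Lemma prefix_lin x c r s : prefix x (c *: r + s) = c *: prefix x r + prefix x s.
Proof.
apply: finsuppP => -[|y u]; rewrite !finsuppE /= ?scaler0 ?addr0 //.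
by case: eqP => _; rewrite ?scaler0 ?addr0.
Qed.

Lemma prefix_word x u : prefix x (word u) = word (x :: u).
Proof.
apply: finsuppP => -[|y w] //=.
by rewrite eqseq_cons; case: (y == x).
Qed.

Lemma prefix_rel x r : ind_rel r -> ind_rel (prefix x r).
Proof.
have pB s t : prefix x (s - t) = prefix x s - prefix x t.
  by rewrite addrC -scaleN1r prefix_lin scaleN1r addrC.
have p0 : prefix x 0 = 0 by rewrite -[X in prefix x X](subrr 0) pB subrr.
elim=> [|c s t _ IHs _ IHt|u v c y z|u v y z|u y py].
- by rewrite p0; exact: ind_rel0.
- by rewrite prefix_lin; exact: ind_relD.
- by rewrite pB prefix_lin !prefix_word -!cat_cons; exact: ind_rel_lin.
- by rewrite !pB !prefix_word -!cat_cons; exact: ind_rel_br.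
- rewrite pB -[_ *: _]addr0 prefix_lin p0 addr0 !prefix_word -rcons_cons.
  exact: ind_rel_char.
Qed.

Lemma act_pi x r : act x (ind_pi r) = ind_pi (prefix x r).
Proof.
apply: ind_eqP.
have := prefix_rel x (ind_eq_repr r).
by rewrite addrC -scaleN1r prefix_lin scaleN1r addrC.
Qed.

Lemma act_linear x : linear (act x).
Proof.
move=> c u v; rewrite -[u]ind_reprK -[v]ind_reprK -pi_ind_lin !act_pi prefix_lin.
exact: pi_ind_lin.
Qed.

HB.instance Definition _ x :=
  GRing.isLinear.Build C ind ind *:%R (act x) (act_linear x).

Lemma act0 x : act x 0 = 0.
Proof. exact: linear0. Qed.

Lemma ind_word_ind (P : ind -> Prop) :
  P 0 -> (forall c u v, P u -> P v -> P (c *: u + v)) ->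
  (forall u, P (ind_pi (word u))) -> forall v, P v.
Proof.
move=> P0 PD Pw v; rewrite -[v]ind_reprK.
apply: (@finsupp_ind C (seq g) (fun r => P (ind_pi r))) => // [|c r s Pr Ps].
  by have := pi_ind_lin (-1) 0 0; rewrite scaler0 addr0 scaleN1r addNr => ->.
by rewrite pi_ind_lin; exact: PD.
Qed.

Lemma act_linearl c x y v : act (c *: x + y) v = c *: act x v + act y v.
Proof.
elim/ind_word_ind: v => [|a u v IHu IHv|u].
- by rewrite !act0 scaler0 addr0.
- rewrite !act_linear IHu IHv !scalerDr !scalerA mulrC !addrA.
  by congr (_ + _); rewrite addrAC.
- rewrite !act_pi !prefix_word -pi_ind_lin; apply: ind_eqP.
  exact: (ind_rel_lin [::]).
Qed.

Lemma act_br x y v : act x (act y v) - act y (act x v) = act (br x y) v.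
Proof.
elim/ind_word_ind: v => [|a u v IHu IHv|u].
- by rewrite !act0 subrr.
- by rewrite !act_linear -IHu -IHv scalerBr opprD addrACA.
- rewrite !act_pi !prefix_word; apply/eqP; rewrite subr_eq -pi_indD; apply/eqP.
  by apply: ind_eqP; rewrite opprD addrA addrAC; exact: (ind_rel_br [::]).
Qed.

Lemma act_vac x : p x -> act x vac = chi x *: vac.
Proof.
move=> px; rewrite /vac act_pi prefix_word; apply: etrans _ (esym (pi_ind_scale (chi x) (word [::]))).
by apply: ind_eqP; exact: (ind_rel_char [::] px).
Qed.

End Induced.

Section VectorDerivative.
Variables (C : numFieldType) (V : lmodType C).

(* V carries no topology: f is required to take its values, near x, in a
   finite-dimensional subspace, where it is differentiated coordinatewise. *)
Definition is_vderive (f : C -> V) (x : C) (d : V) : Prop :=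
  exists (n : nat) (c : 'I_n -> C^o -> C^o) (dc : 'I_n -> C) (e : 'I_n -> V),
  [/\ \forall t \near x, f t = \sum_(j < n) c j t *: e j,
      forall j, is_derive (x : C^o) 1 (c j) (dc j) &
      d = \sum_(j < n) dc j *: e j].

Lemma is_vderive0 n (c : 'I_n -> C^o -> C^o) (dc : 'I_n -> C) (e : 'I_n -> V)
    (x : C) :
  (\forall t \near x, \sum_(j < n) c j t *: e j = 0) ->
  (forall j, is_derive (x : C^o) 1 (c j) (dc j)) ->
  \sum_(j < n) dc j *: e j = 0.
Proof.
elim: n c dc e => [|n IH] c dc e c0 dcP; first by rewrite big_ord0.
have [[b [b0 [j bj]]]|free] := pselect
  (exists b : 'I_n.+1 -> C, \sum_j b j *: e j = 0 /\ exists j, b j != 0).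
- have ej : e j = - \sum_(i < n) (b (lift j i) / b j) *: e (lift j i).
    move: b0; rewrite (bigD1_ord j) //= => /eqP; rewrite addr_eq0 => /eqP b0.
    rewrite -[LHS](scalerK bj) b0 scalerN scaler_sumr; congr (- _).
    by apply: eq_bigr => i _; rewrite scalerA mulrC.
  have elimj (h : 'I_n.+1 -> C) : \sum_j h j *: e j =
      \sum_(i < n) (h (lift j i) - (b (lift j i) / b j) * h j) *: e (lift j i).
    rewrite (bigD1_ord j) //= [in X in X + _]ej scalerN scaler_sumr addrC.
    rewrite -sumrB; apply: eq_bigr => i _.
    by rewrite scalerBl scalerA [h j * _]mulrC.
  rewrite elimj.
  apply: (IH (fun i t => c (lift j i) t - (b (lift j i) / b j) * c j t)
    (fun i => dc (lift j i) - (b (lift j i) / b j) * dc j)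
    (fun i => e (lift j i))).
  by near=> t; apply: etrans (esym (elimj (c^~ t))) _; near: t.
- apply: big1 => j _; suff -> : dc j = 0 by rewrite scale0r.
  have cj0 : \forall t \near (x : C^o), (cst 0 : C^o -> C^o) t = c j t.
    near=> t; apply/esym/eqP/negPn/negP => cjt; apply: free.
    by exists (c^~ t); split; [near: t | exists j].
  have [_ <-] := dcP j.
  by rewrite -(near_eq_derive _ cj0) // derive_cst.
Unshelve. all: by end_near. Qed.

Lemma is_vderive_unique (f : C -> V) (x : C) (d1 d2 : V) :
  is_vderive f x d1 -> is_vderive f x d2 -> d1 = d2.
Proof.
move=> [n [c [dc [e [fc dcP ->]]]]] [m [b [db [h [fb dbP ->]]]]].
apply/eqP; rewrite -subr_eq0; apply/eqP.
pose app (W : Type) (u : 'I_n -> W) (v : 'I_m -> W) (j : 'I_(n + m)) :=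
  match fintype.split j with inl i => u i | inr i => v i end.
have appl W u v i : @app W u v (lshift m i) = u i.
  by rewrite /app (unsplitK (inl _ i)).
have appr W u v i : @app W u v (rshift n i) = v i.
  by rewrite /app (unsplitK (inr _ i)).
have appE (u : 'I_n -> C) (v : 'I_m -> C) :
    \sum_j app C u (\- v) j *: app V e h j
    = \sum_j u j *: e j - \sum_j v j *: h j.
  rewrite big_split_ord /= -sumrN; congr (_ + _); apply: eq_bigr => i _.
    by rewrite !appl.
  by rewrite !appr scaleNr.
rewrite -appE.
apply: (@is_vderive0 _ (fun j t => app C (c^~ t) (\- (b^~ t)) j) _ _ x).
  near=> t; rewrite appE; apply/eqP; rewrite subr_eq0; apply/eqP.
  by transitivity (f t); [apply/esym|]; near: t.
move=> j; case: (split_ordP j) => i ->.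
  rewrite appl (_ : (fun t => _) = c i) //.
  by apply/funext => t; rewrite appl.
rewrite appr (_ : (fun t => _) = - b i) /=; last first.
  by apply/funext => t; rewrite appr.
exact: is_deriveN.
Unshelve. all: by end_near. Qed.

Definition vderive (f : C -> V) (x : C) : V := xget 0 [set d | is_vderive f x d].

Lemma vderiveE (f : C -> V) (x : C) (d : V) :
  is_vderive f x d -> vderive f x = d.
Proof.
move=> fd; apply: (is_vderive_unique _ fd).
by apply: (xgetPex 0 (P := [set d | is_vderive f x d])); exists d.
Qed.

End VectorDerivative.

Section VacuumModule.
Variables (C : numFieldType) (M N : nat) (zs k : 'I_N -> C).
Local Notation sl := (sl C M).
Local Notation affine := (affine C M).

Definition vacuum_module :=
  ind (@affineN_br C M N) (@annihilation C M N) (level_char k).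
HB.instance Definition _ := GRing.Lmodule.on vacuum_module.
Local Notation V := vacuum_module.

Definition vacuum : V :=
  vac (@affineN_br C M N) (@annihilation C M N) (level_char k).

Definition lact (x : affineN C M N) : V -> V := @act _ _ _ _ _ x.

Lemma lact_linear x : linear (lact x).
Proof. exact: act_linear. Qed.

HB.instance Definition _ x :=
  GRing.isLinear.Build C V V *:%R (lact x) (lact_linear x).

Lemma lact_linearl c x y v : lact (c *: x + y) v = c *: lact x v + lact y v.
Proof. exact: act_linearl. Qed.

Lemma lact_br x y v :
  lact x (lact y v) - lact y (lact x v) = lact (affineN_br x y) v.
Proof. exact: act_br. Qed.

Lemma lact_vacuum x :
  annihilation x -> lact x vacuum = level_char k x *: vacuum.
Proof. exact: act_vac. Qed.

(* Y X n v stands for X_(n) v, that is Y(X,u) v is the sum over n of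
   u^(-n-1) (Y X n v). These conditions determine T and Y. In Y_normal, the
   hypothesis says that the terms with j >= K of the (finite) sum giving the
   modes of the normal ordered product vanish. *)
Record is_vertex_structure (T : V -> V) (Y : V -> int -> V -> V) : Prop := {
  T_linear : linear T;
  T_vacuum : T vacuum = 0;
  T_mode : forall (i : 'I_N) (a : sl) (n : int) (v : V),
    T (lact (copy i (mode a n)) v) - lact (copy i (mode a n)) (T v)
    = (- n)%:~R *: lact (copy i (mode a (n - 1))) v;
  Y_linearl : forall n v, linear (fun X => Y X n v);
  Y_linearr : forall X n, linear (Y X n);
  Y_field : forall X v, exists K : int, forall n, K <= n -> Y X n v = 0;
  Y_vacuum : forall n v, Y vacuum n v = if n == -1 then v else 0;
  Y_mode : forall (i : 'I_N) (a : sl) (n : int) (v : V),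
    Y (lact (copy i (mode a (-1))) vacuum) n v = lact (copy i (mode a n)) v;
  Y_translation : forall X n v, Y (T X) n v = (- n)%:~R *: Y X (n - 1) v;
  Y_normal : forall X X' n v (K : nat),
    (forall j : nat, (K <= j)%N -> Y X j%:Z v = 0 /\ Y X' (n + j%:Z) v = 0) ->
    Y (Y X (-1) X') n v =
    \sum_(j < K) (Y X (-1 - j%:Z) (Y X' (n + j%:Z) v)
                  + Y X' (n - 1 - j%:Z) (Y X j%:Z v)) }.

Definition eval (A : affine) (z : C) : affineN C M N :=
  \sum_(i < N) (z - zs i)^-1 *: copy i A.

Definition twist (z : C) : C := \sum_(i < N) k i / (z - zs i).

Definition tderive (j : nat) (f : C -> V) (z : C) : V :=
  vderive f z - (j%:R / M%:R * twist z) *: f z.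

Variables (d : nat) (I : d.-tuple sl).

Definition Iop (a : 'I_d) (n : int) (z : C) : V -> V :=
  lact (eval (mode (tnth I a) n) z).

Definition tcoef (a b c : 'I_d) : C :=
  let m i := vsval (tnth I i) in
  \tr (m a *m m b *m m c + m b *m m a *m m c).

Definition varsigma1 (z : C) : V :=
  2^-1 *: \sum_(a < d) Iop a (-1) z (Iop a (-1) z vacuum).

Definition varsigma2 (z : C) : V :=
  3^-1 *: \sum_(a < d) \sum_(b < d) \sum_(c < d)
    tcoef a b c *: Iop a (-1) z (Iop b (-1) z (Iop c (-1) z vacuum)).

Definition omega_site (i : 'I_N) : V :=
  (2 * (k i + M%:R))^-1 *: \sum_(a < d)
    lact (copy i (mode (tnth I a) (-1)))
      (lact (copy i (mode (tnth I a) (-1))) vacuum).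

Definition omega (z : C) : V := \sum_(i < N) (z - zs i)^-1 *: omega_site i.

Definition s1 (z : C) : V := varsigma1 z + M%:R *: tderive 1 omega z.

Definition A11 (z w : C) : V :=
  (M%:R / (z - w)) *: \sum_(a < d) Iop a (-2) z (Iop a (-1) w vacuum).

Definition B11 (z w : C) : V :=
  (M%:R / (z - w) ^+ 2) *: \sum_(a < d) Iop a (-1) z (Iop a (-1) w vacuum).

Definition A12 (z w : C) : V :=
  (M%:R / (2 * (z - w))) *: \sum_(a < d) \sum_(b < d) \sum_(c < d)
    tcoef a b c *: Iop a (-2) z (Iop b (-1) w (Iop c (-1) w vacuum)).

Definition B12 (z w : C) : V :=
  (M%:R / (2 * (z - w) ^+ 2)) *: \sum_(a < d) \sum_(b < d) \sum_(c < d)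
    tcoef a b c *: Iop a (-1) z (Iop b (-1) w (Iop c (-1) w vacuum)).

End VacuumModule.

(* Main.v *)
Require Import Defs.
From mathcomp Require Import all_boot all_order all_algebra.
From mathcomp Require Import boolp functions reals topology normedtype derive.
From mathcomp Require Import complex ring.

Import Order.TTheory GRing.Theory Num.Theory.
Import numFieldNormedType.Exports.
Local Open Scope ring_scope.

(** A function [f] on the set of sites gives the weighted modes [f_n x], the sums
    over the sites [i] of [f_i] times the action of [x_n] in the [i]-th copy. By
    [op_comm] they satisfy the relations of a central extension of the loop algebra
    of [sl_M] tensored with the algebra of functions on the sites:
      [f_m x, g_n y] = (f g)_(m+n) [x, y] - n delta_(m+n,0) (x|y) level(f g).
    The rational currents at [z] are the modes of weight [p = (1 / (z - z_i))_i], those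
    at [w] have weight [q = (1 / (w - z_i))_i], and the whole dependence on the points
    is contained in the partial fraction identity [p q = (q - p) / (z - w)], in
    [q' = - q^2], and in the fact that the twist function at [z] is [level p].

    The zero mode of [s_1 z] annihilates the vacuum, and its action on products of
    currents follows from its commutator with [q_(-1) b], which is computed in
    [s1_mode_comm]. For a quadratic state of weight [p] the commutator is obtained by
    invariance of the Casimir tensor ([sugawara_comm]); at a single site it reduces to
    the Sugawara identity, and the [omega] part of [s_1 z] is such that all terms with
    [p^2] disappear. What is left, up to the factor [1 / (z - w)], is a term
    [p_(-1) I^a q_(-1) [I^a, b]], terms [p_(-2-j) I^a q_j [I^a, b]] minus the same with
    [p] and [q] exchanged, and a mode of degree -2 of [b].

    It remains to contract with the Casimir tensor, resp. with the invariant cubic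
    tensor [t_abc]. The first term contributes only through commutators of currents
    ([quadratic_part2], [quadratic_part3]); its contribution cancels the part of the
    last one that does not involve the levels. In the others only [j = 0] survives
    ([tail_modes2], [tail_modes3l], [tail_modes3r]), by antisymmetry and by the
    vanishing of the trace of [t]. All the constants come from the value [2 M] of the
    Casimir operator in the adjoint representation; on the cubic tensor, whose partial
    contractions also lie in adjoint representations, a pair of adjoint actions
    in two distinct slots is therefore worth [M - 2 M = - M] ([cubic3_ad_ad]). The
    resulting formulas, [s1_mode_W2] and [s1_mode_W3], are compared with the right-hand
    side after expansion of the translation operator and of the derivatives. *)

Set Implicit Arguments.
Unset Strict Implicit.
Unset Printing Implicit Defensive.

(** * Linear combinations in a module *)

(** The tactic [lmod_eq C] reduces an equation between linear combinations of
    arbitrary vectors of an [lmodType C] to the equations between the coefficients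
    of each vector, to be closed by [ring] or [field]. *)

Section LmodReflection.
Variable C : pzRingType.

(** Syntax of linear combinations; the atoms are numbered. *)
Inductive mterm :=
| MAtom of nat | MZero | MAdd of mterm & mterm | MOpp of mterm
| MScale of C & mterm.

Fixpoint meval (V : lmodType C) (e : seq V) (t : mterm) : V :=
  match t with
  | MAtom i => e`_i
  | MZero => 0
  | MAdd s t => meval e s + meval e t
  | MOpp t => - meval e t
  | MScale c t => c *: meval e t
  end.

(** Coefficient of the [i]-th atom. *)
Fixpoint mcoef (t : mterm) (i : nat) : C :=
  match t with
  | MAtom j => if i == j then 1 else 0
  | MZero => 0
  | MAdd s t => mcoef s i + mcoef t i
  | MOpp t => - mcoef t i
  | MScale c t => c * mcoef t i
  end.

Fixpoint mbounded (n : nat) (t : mterm) : bool :=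
  match t with
  | MAtom j => (j < n)%N
  | MZero => true
  | MAdd s t => mbounded n s && mbounded n t
  | MOpp t | MScale _ t => mbounded n t
  end.

Fixpoint mcoef_eq (n : nat) (s t : mterm) : Prop :=
  if n is n'.+1 then mcoef s n' = mcoef t n' /\ mcoef_eq n' s t else True.

Lemma mevalE (V : lmodType C) (e : seq V) t : mbounded (size e) t ->
  meval e t = \sum_(i < size e) mcoef t i *: e`_i.
Proof.
elim: t => [j /= lt_j||s IHs t IHt /andP[/IHs es /IHt et]|t IHt /IHt et|
    c t IHt /IHt et] /=.
- rewrite (bigD1 (Ordinal lt_j)) //= eqxx scale1r big1 ?addr0 // => i.
  by rewrite -val_eqE /= => /negPf ->; rewrite scale0r.
- by rewrite big1 // => i _; rewrite scale0r.
- by rewrite es et -big_split /=; apply: eq_bigr => i _; rewrite scalerDl.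
- by rewrite et -sumrN; apply: eq_bigr => i _; rewrite scaleNr.
- by rewrite et scaler_sumr; apply: eq_bigr => i _; rewrite scalerA.
Qed.

Lemma meval_eq (V : lmodType C) (e : seq V) s t :
  mbounded (size e) s && mbounded (size e) t -> mcoef_eq (size e) s t ->
  meval e s = meval e t.
Proof.
move=> /andP[es et] st; rewrite !mevalE //; apply: eq_bigr => i _.
congr (_ *: _); elim: (size e) i st => [[]//|n IH] i /= [stn /IH st].
by case: (unliftP ord_max i) => [j ->|-> //]; have := st j; rewrite lift_max.
Qed.
End LmodReflection.

(* Atoms are compared up to conversion, since the same vector can occur with
   different paths to its module structure. *)
Ltac lmod_index x e :=
  lazymatch e with
  | ?y :: ?e' =>
    match constr:(Set) with
    | _ => let _ := match constr:(Set) with _ => constr_eq x y end in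
           constr:(0%N)
    | _ => let _ := match constr:(Set) with _ => unify x y end in
           constr:(0%N)
    | _ => let i := lmod_index x e' in constr:(S i)
    end
  end.

Ltac lmod_add x e :=
  lazymatch e with
  | nil => constr:(x :: e)
  | ?y :: ?e' =>
    match constr:(Set) with
    | _ => let _ := match constr:(Set) with _ => constr_eq x y end in e
    | _ => let _ := match constr:(Set) with _ => unify x y end in e
    | _ => let e'' := lmod_add x e' in constr:(y :: e'')
    end
  end.

Ltac lmod_atoms t e :=
  lazymatch t with
  | @GRing.add _ ?x ?y => let e' := lmod_atoms x e in lmod_atoms y e'
  | @GRing.opp _ ?x => lmod_atoms x e
  | @GRing.scale _ _ _ ?x => lmod_atoms x e
  | @GRing.zero _ => e
  | _ => lmod_add t e
  end.

Ltac lmod_reify C t e :=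
  lazymatch t with
  | @GRing.add _ ?x ?y =>
    let s := lmod_reify C x e in let s' := lmod_reify C y e in
    constr:(MAdd s s')
  | @GRing.opp _ ?x => let s := lmod_reify C x e in constr:(MOpp s)
  | @GRing.scale _ _ ?c ?x =>
    let s := lmod_reify C x e in constr:(@MScale C c s)
  | @GRing.zero _ => constr:(@MZero C)
  | _ => let i := lmod_index t e in constr:(@MAtom C i)
  end.

Ltac lmod_eq C :=
  lazymatch goal with |- @eq ?T ?l ?r =>
    let V := constr:(T : lmodType C) in
    let e0 := constr:(@nil T) in
    let e1 := lmod_atoms l e0 in
    let e := lmod_atoms r e1 in
    let s := lmod_reify C l e in
    let t := lmod_reify C r e in
    apply: (@meval_eq C V e s t isT);
    rewrite /mcoef_eq /mcoef /=; repeat split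
  end.

(** Unbundled linear maps: the maps below are linear in one of several arguments,
    and their linearity is a hypothesis or a lemma. *)
Section LinearMaps.
Variables (C : pzRingType) (U V : lmodType C) (f : U -> V).
Hypothesis fL : linear f.

Lemma lin0 : f 0 = 0.
Proof. by have := fL (-1) 0 0; rewrite scaler0 addr0 scaleN1r addNr. Qed.

Lemma linZ c x : f (c *: x) = c *: f x.
Proof. by have := fL c x 0; rewrite lin0 !addr0. Qed.

Lemma linN x : f (- x) = - f x.
Proof. by rewrite -[- x]scaleN1r linZ scaleN1r. Qed.

Lemma linD x y : f (x + y) = f x + f y.
Proof. by have := fL 1 x y; rewrite !scale1r. Qed.

Lemma lin_comb (J : Type) (s : seq J) (c : J -> C) (v : J -> U) :
  f (\sum_(j <- s) c j *: v j) = \sum_(j <- s) c j *: f (v j).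
Proof.
elim: s => [|j s IH]; first by rewrite !big_nil lin0.
by rewrite !big_cons fL IH.
Qed.

Lemma lin_sum (J : Type) (s : seq J) (v : J -> U) :
  f (\sum_(j <- s) v j) = \sum_(j <- s) f (v j).
Proof.
elim: s => [|j s IH]; first by rewrite !big_nil lin0.
by rewrite !big_cons linD IH.
Qed.
End LinearMaps.

(** * The invariant tensors of sl_M *)

Section SlTensors.
Variables (C : numFieldType) (M : nat) (d : nat) (I : d.-tuple (sl C M)).
Local Notation sl := (sl C M).
Implicit Types (x y z u : sl) (V : lmodType C).

Lemma vsvalP c x y : vsval (c *: x + y) = c *: vsval x + vsval y.
Proof. exact: linearP. Qed.

Lemma sl_brPl c x y z : sl_br (c *: x + y) z = c *: sl_br x z + sl_br y z.
Proof.
apply/val_inj; rewrite [LHS]sl_brE [RHS]vsvalP !sl_brE vsvalP.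
set X := vsval x; set Y := vsval y; set Z := vsval z.
have -> : (c *: X + Y) *m Z = c *: (X *m Z) + Y *m Z.
  by rewrite mulmxDl scalemxAl.
have -> : Z *m (c *: X + Y) = c *: (Z *m X) + Z *m Y.
  by rewrite mulmxDr scalemxAr.
by lmod_eq C; ring.
Qed.

Lemma sl_brC x y : sl_br x y = - sl_br y x.
Proof.
by apply/val_inj; rewrite [LHS]sl_brE [RHS]linearN /= sl_brE opprB.
Qed.

Lemma sl_brPr c x y z : sl_br z (c *: x + y) = c *: sl_br z x + sl_br z y.
Proof. by rewrite sl_brC sl_brPl opprD -scalerN -!(sl_brC z). Qed.

Lemma sl_brNr x y : sl_br x (- y) = - sl_br x y.
Proof. by rewrite -[- y]addr0 -scaleN1r sl_brPr scaleN1r sl_br0r addr0. Qed.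

Lemma sl_brNl x y : sl_br (- x) y = - sl_br x y.
Proof. by rewrite sl_brC sl_brNr sl_brC !opprK. Qed.

Lemma trformPl c x y z : trform (c *: x + y) z = c * trform x z + trform y z.
Proof. by rewrite /trform linearP /= mulmxDl -scalemxAl linearP. Qed.

Lemma trformC x y : trform x y = trform y x.
Proof. exact: mxtrace_mulC. Qed.

Lemma trformPr c x y z : trform z (c *: x + y) = c * trform z x + trform z y.
Proof. by rewrite trformC trformPl !(trformC z). Qed.

Lemma trform_inv x y z : trform (sl_br x y) z = trform x (sl_br y z).
Proof.
rewrite /trform !sl_brE mulmxBl mulmxBr !raddfB /= !mulmxA; congr (_ - _).
by rewrite -[in LHS]mulmxA mxtrace_mulC.
Qed.

Lemma trformNl x y : trform (- x) y = - trform x y.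
Proof. by rewrite -[- x]addr0 -scaleN1r trformPl trform0l mulN1r addr0. Qed.

Lemma trform_skew u x y : trform x (sl_br u y) = - trform y (sl_br u x).
Proof. by rewrite -trform_inv sl_brC trformNl trformC. Qed.

Hypothesis I_basis : basis_of fullv I.
Hypothesis I_orth : forall a b : 'I_d, trform (tnth I a) (tnth I b) = (a == b)%:R.

Lemma sl_expand x : x = \sum_(a < d) trform (tnth I a) x *: tnth I a.
Proof.
have trform_lin y : linear (trform y : sl -> C^o).
  by move=> c u v; apply: trformPr.
rewrite {1}(coord_basis I_basis (memvf x)); apply: eq_bigr => a _.
rewrite -tnth_nth; congr (_ *: _).
rewrite {2}(coord_basis I_basis (memvf x)) (lin_comb (trform_lin _)).
rewrite (bigD1 a) //= big1 ?addr0 => [|b /negPf ba].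
  by rewrite -tnth_nth I_orth eqxx; apply/esym/mulr1.
by rewrite -tnth_nth I_orth eq_sym ba; apply: mulr0.
Qed.

(** Completeness of the basis, in terms of matrix entries. The orthogonal
    complement of [sl_M] in the matrix algebra is spanned by the identity, which
    accounts for the second term. The matrix [X] of the proof is the projection
    to [sl_M] of an elementary matrix. *)
Lemma basis_completeness (i j r s : 'I_M) :
  \sum_(a < d) vsval (tnth I a) i j * vsval (tnth I a) r s
  = (i == s)%:R * (j == r)%:R - (i == j)%:R * (r == s)%:R / M%:R.
Proof.
have M0 : M%:R != 0 :> C by rewrite pnatr_eq0 -lt0n (leq_ltn_trans _ (ltn_ord i)).
pose X : 'M[C]_M := delta_mx j i - ((i == j)%:R / M%:R)%:M.
have trX : X \in sl_space C M.
  rewrite mem_sl_space /X linearB /= mxtrace_scalar /mxtrace.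
  rewrite (bigD1 j) //= big1 ?addr0 => [|l /negPf lj]; last by rewrite mxE lj.
  rewrite mxE eqxx /= [j == i]eq_sym -[_ *+ M]mulr_natr.
  by rewrite -mulrA mulVf // mulr1 subrr.
have trIX a : trform (tnth I a) (vsproj _ X) = vsval (tnth I a) i j.
  rewrite /trform vsprojK // /X mulmxBr linearB /= mul_mx_scalar linearZ /=.
  have := subvsP (tnth I a); rewrite mem_sl_space => /eqP ->.
  rewrite mulr0 subr0 /mxtrace (bigD1 i) //= big1 ?addr0 => [|l /negPf li].
    rewrite mxE (bigD1 j) //= big1 ?addr0 => [|l /negPf lj].
      by rewrite mxE !eqxx mulr1.
    by rewrite mxE lj mulr0.
  by rewrite mxE big1 // => l' _; rewrite mxE li andbF mulr0.
have /(congr1 (fun Z : sl => vsval Z r s)) := sl_expand (vsproj _ X).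
rewrite vsprojK //.
have -> : vsval (\sum_(a < d) trform (tnth I a) (vsproj _ X) *: tnth I a) r s
    = \sum_(a < d) vsval (tnth I a) i j * vsval (tnth I a) r s.
  elim/big_rec2: _ => [|a y1 y2 _ IH]; first by rewrite [vsval 0]linear0 mxE.
  by rewrite vsvalP !mxE trIX IH.
move=> <-; rewrite !mxE -natrM mulnb [s == i]eq_sym [r == j]eq_sym.
by rewrite andbC; congr (_ - _); rewrite -[LHS]mulr_natr mulrAC.
Qed.

Lemma basis_sandwich (Z : 'M[C]_M) :
  \sum_(a < d) vsval (tnth I a) *m Z *m vsval (tnth I a)
  = (\tr Z)%:M - M%:R^-1 *: Z.
Proof.
apply/matrixP => i s; rewrite summxE.
transitivity (\sum_r \sum_j
    (Z j r * ((i == s)%:R * (j == r)%:R)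
     - Z j r * ((i == j)%:R * (r == s)%:R / M%:R))).
  transitivity (\sum_(a < d) \sum_r \sum_j
      Z j r * (vsval (tnth I a) i j * vsval (tnth I a) r s)).
    apply: eq_bigr => a _; rewrite mxE; apply: eq_bigr => r _.
    by rewrite mxE mulr_suml; apply: eq_bigr => j _; rewrite mulrAC mulrC.
  rewrite exchange_big; apply: eq_bigr => r _.
  rewrite exchange_big; apply: eq_bigr => j _.
  by rewrite -mulr_sumr basis_completeness mulrBr.
under eq_bigr do rewrite sumrB.
rewrite sumrB !mxE; congr (_ - _).
  rewrite /mxtrace -sumrMnl; apply: eq_bigr => r _.
  rewrite (bigD1 r) //= big1 ?addr0 => [|j /negPf ->]; last by rewrite !mulr0.
  by rewrite eqxx mulr1 mulr_natr.
rewrite (bigD1 s) //= (bigD1 i) //= !eqxx mul1r mulrC.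
rewrite big1 => [|j /negPf ji]; last by rewrite eq_sym ji !(mulr0, mul0r).
rewrite addr0 big1 ?addr0 ?mul1r 1?mulrC // => r /negPf rs.
by rewrite big1 // => j _; rewrite rs !(mulr0, mul0r).
Qed.

Lemma sum_basis_sq : \sum_(a < d) vsval (tnth I a) *m vsval (tnth I a)
  = (M%:R - M%:R^-1)%:M.
Proof.
have := basis_sandwich 1%:M; rewrite mxtrace1 => II.
transitivity (\sum_(a < d) vsval (tnth I a) *m 1%:M *m vsval (tnth I a)).
  by apply: eq_bigr => a _; rewrite mulmx1.
by rewrite II scalemx1 raddfB.
Qed.

(** The Casimir element acts on the adjoint representation by twice the dual
    Coxeter number. *)
Lemma casimir_adjoint x :
  \sum_(a < d) sl_br (tnth I a) (sl_br (tnth I a) x) = (2 * M%:R) *: x.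
Proof.
have [M0|M0] := eqVneq M 0%N.
  (* There are no matrix entries to compare. *)
  apply/val_inj/matrixP => i.
  have : (0 < M)%N := leq_ltn_trans (leq0n i) (ltn_ord i).
  by move: M0 => /eqP; rewrite lt0n => ->.
have Mn0 : M%:R != 0 :> C by rewrite pnatr_eq0.
apply/val_inj.
have vsval_sum (F : 'I_d -> sl) :
    vsval (\sum_a F a) = \sum_a vsval (F a).
  by elim/big_rec2: _ => [|a y1 y2 _ <-]; rewrite ?[LHS]linear0 // [LHS]linearD.
rewrite [LHS]vsval_sum [RHS]linearZ /=.
have xtr : \tr (vsval x) = 0.
  by apply/eqP; have := subvsP x; rewrite mem_sl_space.
pose J a : 'M_M := vsval (tnth I a); pose Z : 'M_M := vsval x.
have II : \sum_(a < d) J a *m J a = _ := sum_basis_sq.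
transitivity ((\sum_(a < d) J a *m J a) *m Z
    - 2 *: (\sum_(a < d) J a *m Z *m J a) + Z *m (\sum_(a < d) J a *m J a)).
  rewrite mulmx_suml mulmx_sumr scaler_sumr -sumrB -big_split /=.
  apply: eq_bigr => a _; rewrite !sl_brE -/(J a) -/Z !mulmxBr !mulmxBl !mulmxA.
  by lmod_eq C; ring.
rewrite basis_sandwich II xtr mul_scalar_mx mul_mx_scalar -/Z.
have -> : (0 : C)%:M = 0 :> 'M_M by apply/matrixP => i j; rewrite !mxE mul0rn.
by lmod_eq C; field.
Qed.

(** The symmetric invariant trilinear form whose coefficients in the basis are
    the numbers t_abc. *)
Definition cubic x y z : C :=
  \tr (vsval x *m vsval y *m vsval z + vsval y *m vsval x *m vsval z).

Lemma cubicC12 x y z : cubic x y z = cubic y x z.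
Proof. by rewrite /cubic addrC. Qed.

Lemma cubicC23 x y z : cubic x y z = cubic x z y.
Proof.
rewrite /cubic !linearD /= addrC; congr (_ + _).
  by rewrite -[in LHS]mulmxA mxtrace_mulC.
by rewrite mxtrace_mulC mulmxA.
Qed.

Lemma cubicPl c x x' y z :
  cubic (c *: x + x') y z = c * cubic x y z + cubic x' y z.
Proof.
rewrite /cubic vsvalP !(mulmxDl, mulmxDr) -!scalemxAl -!scalemxAr -!scalemxAl.
by rewrite !mxtraceD !mxtraceZ mulrDr addrACA.
Qed.

Lemma cubic_inv u x y z :
  cubic (sl_br u x) y z + cubic x (sl_br u y) z + cubic x y (sl_br u z) = 0.
Proof.
rewrite /cubic !sl_brE.
set U := vsval u; set X := vsval x; set Y := vsval y; set Z := vsval z.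
rewrite !(mulmxBl, mulmxBr) !mulmxA !(mxtraceD, raddfB, raddfN) /=.
rewrite !(mxtrace_mulC _ U) !mulmxA; ring.
Qed.

(** The cubic form is traceless, because the quadratic Casimir element of the
    defining representation is a scalar. *)
Lemma cubic_trace x : \sum_(a < d) cubic (tnth I a) (tnth I a) x = 0.
Proof.
transitivity (\tr (2 *: ((\sum_(a < d) vsval (tnth I a) *m vsval (tnth I a))
    *m vsval x))).
  rewrite mulmx_suml scaler_sumr raddf_sum; apply: eq_bigr => a _.
  by rewrite scaler_nat mulr2n.
have := subvsP x; rewrite mem_sl_space sum_basis_sq => /eqP x0.
by rewrite mul_scalar_mx !linearZ /= x0 !mulr0.
Qed.
End SlTensors.

(** * Contractions of multilinear maps with the invariant tensors *)

Section Contractions.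
Variables (C : numFieldType) (M d : nat) (I : d.-tuple (sl C M)) (V : lmodType C).
Local Notation sl := (sl C M).
Hypothesis I_basis : basis_of fullv I.
Hypothesis I_orth : forall a b : 'I_d, trform (tnth I a) (tnth I b) = (a == b)%:R.
Implicit Types (F G : sl -> sl -> sl -> V) (u : sl).

Lemma linear_casimir (f : sl -> V) x : linear f ->
  \sum_(a < d) f (sl_br (tnth I a) (sl_br (tnth I a) x)) = (2 * M%:R) *: f x.
Proof.
move=> fL; rewrite -(linZ fL) -(casimir_adjoint I_basis I_orth).
by rewrite (lin_sum fL).
Qed.

(** Contraction of a bilinear map with the quadratic Casimir tensor. *)
Definition casimir2 (F : sl -> sl -> V) : V := \sum_(a < d) F (tnth I a) (tnth I a).

(** A map of two arguments, linear in each. *)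
Definition bilin (F : sl -> sl -> V) :=
  (forall y, linear (F^~ y)) /\ (forall x, linear (F x)).

Lemma casimir2_inv (F : sl -> sl -> V) u : bilin F ->
  casimir2 (fun x y => F x (sl_br u y)) = - casimir2 (fun x y => F (sl_br u x) y).
Proof.
move=> [Fl Fr]; rewrite /casimir2 -sumrN.
transitivity (\sum_(a < d) \sum_(b < d)
    trform (tnth I b) (sl_br u (tnth I a)) *: F (tnth I a) (tnth I b)).
  apply: eq_bigr => a _.
  by rewrite [in LHS](sl_expand I_basis I_orth (sl_br _ _)) (lin_comb (Fr _)).
rewrite exchange_big; apply: eq_bigr => a _.
rewrite [in RHS](sl_expand I_basis I_orth (sl_br _ _)).
rewrite (lin_comb (Fl _)) -sumrN; apply: eq_bigr => b _.
by rewrite -scaleNr trform_skew.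
Qed.

Lemma casimir2_invr (F : sl -> sl -> V) b : bilin F ->
  casimir2 (fun x y => F x (sl_br y b)) = - casimir2 (fun x y => F (sl_br x b) y).
Proof.
move=> FB; have [Fl Fr] := FB; apply/oppr_inj.
have -> : - casimir2 (fun x y => F x (sl_br y b)) =
    casimir2 (fun x y => F x (sl_br b y)).
  rewrite /casimir2 -sumrN; apply: eq_bigr => a _.
  by rewrite [in RHS]sl_brC (linN (Fr _)).
rewrite casimir2_inv // opprK /casimir2 -sumrN; apply: eq_bigr => a _.
by rewrite sl_brC (linN (Fl _)) opprK.
Qed.

(** Contraction of a trilinear map with the cubic tensor. *)
Definition cubic3 F : V :=
  \sum_(a < d) \sum_(b < d) \sum_(c < d)
    cubic (tnth I a) (tnth I b) (tnth I c) *: F (tnth I a) (tnth I b) (tnth I c).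

(** A map of three arguments, linear in each. *)
Definition trilin F :=
  [/\ forall y z, linear (fun x => F x y z), forall x z, linear (fun y => F x y z)
    & forall x y, linear (F x y)].

Lemma eq_cubic3 F G : (forall x y z, F x y z = G x y z) -> cubic3 F = cubic3 G.
Proof.
by move=> FG; do 3! apply: eq_bigr => ? _; rewrite FG.
Qed.

Lemma cubic3D F G : cubic3 (fun x y z => F x y z + G x y z) = cubic3 F + cubic3 G.
Proof.
rewrite /cubic3 -big_split; apply: eq_bigr => a _.
rewrite -big_split; apply: eq_bigr => b _.
by rewrite -big_split; apply: eq_bigr => c _; rewrite /= scalerDr.
Qed.

Lemma cubic3Z k F : cubic3 (fun x y z => k *: F x y z) = k *: cubic3 F.
Proof.
rewrite /cubic3 scaler_sumr; apply: eq_bigr => a _.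
rewrite scaler_sumr; apply: eq_bigr => b _.
by rewrite scaler_sumr; apply: eq_bigr => c _; rewrite !scalerA mulrC.
Qed.

Lemma cubic3_0 : cubic3 (fun _ _ _ => 0) = 0.
Proof. by do 3! (apply: big1 => ? _); rewrite scaler0. Qed.

Lemma cubic3_sum n (F : 'I_n -> sl -> sl -> sl -> V) :
  cubic3 (fun x y z => \sum_(i < n) F i x y z) = \sum_(i < n) cubic3 (F i).
Proof.
elim: n F => [|n IH] F.
  rewrite big_ord0; apply: etrans cubic3_0; apply: eq_cubic3 => x y z.
  by rewrite big_ord0.
rewrite big_ord_recr /= -IH -cubic3D; apply: eq_cubic3 => x y z.
by rewrite big_ord_recr.
Qed.

Lemma cubic3C12 F : cubic3 F = cubic3 (fun x y z => F y x z).
Proof.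
rewrite /cubic3 exchange_big; apply: eq_bigr => a _; apply: eq_bigr => b _.
by apply: eq_bigr => c _; rewrite cubicC12.
Qed.

Lemma cubic3C23 F : cubic3 F = cubic3 (fun x y z => F x z y).
Proof.
apply: eq_bigr => a _; rewrite exchange_big; apply: eq_bigr => b _.
by apply: eq_bigr => c _; rewrite cubicC23.
Qed.

(** Maps skew in two slots are killed by the symmetric tensor; this removes all
    the commutators of two contracted currents. *)
Lemma cubic3_skew12 F : (forall x y z, F x y z = - F y x z) -> cubic3 F = 0.
Proof.
move=> Fskew; suff : cubic3 F = - cubic3 F.
  move=> /eqP; rewrite -subr_eq0 opprK -mulr2n -scaler_nat scaler_eq0.
  by rewrite pnatr_eq0 => /eqP.
rewrite {1}cubic3C12 -scaleN1r -cubic3Z; apply: eq_cubic3 => x y z.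
by rewrite scaleN1r Fskew.
Qed.

Lemma cubic3_skew23 F : (forall x y z, F x y z = - F x z y) -> cubic3 F = 0.
Proof.
move=> Fskew; suff : cubic3 F = - cubic3 F.
  move=> /eqP; rewrite -subr_eq0 opprK -mulr2n -scaler_nat scaler_eq0.
  by rewrite pnatr_eq0 => /eqP.
rewrite {1}cubic3C23 -scaleN1r -cubic3Z; apply: eq_cubic3 => x y z.
by rewrite scaleN1r Fskew.
Qed.

Lemma cubic3_trace (f : sl -> V) :
  cubic3 (fun x y z => trform x y *: f z) = 0.
Proof.
rewrite /cubic3; under eq_bigr do rewrite exchange_big.
rewrite exchange_big; apply: big1 => c _ /=.
transitivity ((\sum_(a < d) cubic (tnth I a) (tnth I a) (tnth I c)) *: f (tnth I c)).
  rewrite scaler_suml; apply: eq_bigr => a _.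
  rewrite (bigD1 a) //= big1 ?addr0 => [|b /negPf ba].
    by rewrite I_orth eqxx scale1r.
  by rewrite I_orth eq_sym ba scale0r scaler0.
by rewrite (cubic_trace I_basis I_orth) scale0r.
Qed.

(** The adjoint action on a slot of the map is transposed to the adjoint action on
    the cubic tensor. *)
Lemma cubic3_ad1 F u : trilin F -> cubic3 (fun x y z => F (sl_br u x) y z) =
  \sum_(a < d) \sum_(b < d) \sum_(c < d)
    (- cubic (sl_br u (tnth I a)) (tnth I b) (tnth I c))
      *: F (tnth I a) (tnth I b) (tnth I c).
Proof.
move=> [F1 _ _].
have cubic_lin y z : linear (fun x : sl => cubic x y z : C^o).
  by move=> c x x'; apply: cubicPl.
rewrite /cubic3 exchange_big [RHS]exchange_big; apply: eq_bigr => b _.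
rewrite exchange_big [RHS]exchange_big; apply: eq_bigr => c _ /=.
transitivity (\sum_(a < d) \sum_(e < d)
    (cubic (tnth I a) (tnth I b) (tnth I c) * trform (tnth I e) (sl_br u (tnth I a)))
    *: F (tnth I e) (tnth I b) (tnth I c)).
  apply: eq_bigr => a _.
  rewrite [in LHS](sl_expand I_basis I_orth (sl_br _ _)).
  rewrite (lin_comb (F1 _ _)) scaler_sumr.
  by apply: eq_bigr => e _; rewrite scalerA.
rewrite exchange_big; apply: eq_bigr => a _.
rewrite -scaler_suml; congr (_ *: _).
rewrite [in RHS](sl_expand I_basis I_orth (sl_br _ _)) (lin_comb (cubic_lin _ _)).
rewrite -sumrN; apply: eq_bigr => e _.
by rewrite mulrC trform_skew mulNr.
Qed.

Lemma trilinC12 F : trilin F -> trilin (fun x y z => F y x z).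
Proof. by move=> [? ? ?]; split. Qed.

Lemma trilinC23 F : trilin F -> trilin (fun x y z => F x z y).
Proof. by move=> [? ? ?]; split. Qed.

Lemma cubic3_inv F u : trilin F ->
  cubic3 (fun x y z => F (sl_br u x) y z + F x (sl_br u y) z + F x y (sl_br u z))
  = 0.
Proof.
move=> FL; rewrite !cubic3D.
rewrite [X in _ + X + _ = _]cubic3C12 [X in _ + _ + X = _]cubic3C23.
rewrite [X in _ + _ + X = _]cubic3C12.
rewrite (cubic3_ad1 _ FL) (cubic3_ad1 _ (trilinC12 FL)).
rewrite (cubic3_ad1 _ (trilinC12 (trilinC23 FL))).
transitivity (\sum_(a < d) \sum_(b < d) \sum_(c < d)
  (- (cubic (sl_br u (tnth I a)) (tnth I b) (tnth I c)
   + cubic (tnth I a) (sl_br u (tnth I b)) (tnth I c)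
   + cubic (tnth I a) (tnth I b) (sl_br u (tnth I c))))
     *: F (tnth I a) (tnth I b) (tnth I c)).
  rewrite [X in _ + X + _]exchange_big.
  rewrite [X in _ + _ + X]exchange_big.
  under [X in _ + _ + X]eq_bigr do rewrite exchange_big.
  rewrite -!big_split; apply: eq_bigr => a _; rewrite -!big_split.
  apply: eq_bigr => b _; rewrite -!big_split; apply: eq_bigr => c _ /=.
  rewrite -!scalerDl !opprD [cubic (tnth I a) (sl_br _ _) _]cubicC12.
  rewrite [cubic (tnth I a) _ (sl_br _ _)]cubicC23.
  by rewrite [cubic (tnth I a) (sl_br _ _) _]cubicC12.
do 3! (apply: big1 => ? _).
by rewrite cubic_inv oppr0 scale0r.
Qed.

Lemma cubic3_casimir1 F : trilin F ->
  \sum_(e < d) cubic3 (fun x y z => F (sl_br (tnth I e) (sl_br (tnth I e) x)) y z)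
  = (2 * M%:R) *: cubic3 F.
Proof.
move=> [F1 _ _]; rewrite -cubic3_sum -cubic3Z; apply: eq_cubic3 => x y z.
exact: (linear_casimir _ (F1 y z)).
Qed.

Lemma linear_ad (f : sl -> V) u : linear f -> linear (fun x => f (sl_br u x)).
Proof. by move=> lf c x y; rewrite sl_brPr lf. Qed.

(** Two adjoint actions in distinct slots of the cubic tensor, contracted with
    each other. Invariance gives three linear equations between the values for the
    three pairs of slots and the Casimir eigenvalue [2 M]; their solution is [- M]
    for each pair. *)
Lemma cubic3_ad_ad F : trilin F ->
  \sum_(e < d) cubic3 (fun x y z =>
     F (sl_br (tnth I e) x) (sl_br (tnth I e) y) z) = - M%:R *: cubic3 F.
Proof.
move=> FL; have [F1 F2 F3] := FL.
set P12 := LHS.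
pose P13 := \sum_(e < d) cubic3 (fun x y z =>
     F (sl_br (tnth I e) x) y (sl_br (tnth I e) z)).
pose P23 := \sum_(e < d) cubic3 (fun x y z =>
     F x (sl_br (tnth I e) y) (sl_br (tnth I e) z)).
have E1 : (2 * M%:R) *: cubic3 F + P12 + P13 = 0.
  rewrite -(cubic3_casimir1 FL) -!big_split; apply: big1 => e _ /=.
  rewrite -!cubic3D.
  apply: (@cubic3_inv (fun x y z => F (sl_br (tnth I e) x) y z)).
  by split=> *; [apply: (linear_ad (f := fun x => F x _ _))|apply: F2|apply: F3].
have E2 : P12 + (2 * M%:R) *: cubic3 F + P23 = 0.
  rewrite [cubic3 F]cubic3C12 -(cubic3_casimir1 (trilinC12 FL)).
  rewrite -!big_split; apply: big1 => e _ /=.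
  rewrite [X in _ + X + _]cubic3C12 -!cubic3D.
  apply: (@cubic3_inv (fun x y z => F x (sl_br (tnth I e) y) z)).
  by split=> *; [apply: F1|apply: (linear_ad (f := fun y => F _ y _))|apply: F3].
have E3 : P13 + P23 + (2 * M%:R) *: cubic3 F = 0.
  rewrite [cubic3 F]cubic3C23 [X in _ *: X]cubic3C12.
  rewrite -(cubic3_casimir1 (trilinC12 (trilinC23 FL))).
  rewrite -!big_split; apply: big1 => e _ /=.
  rewrite [X in _ + X]cubic3C12 [X in _ + X]cubic3C23 -!cubic3D.
  apply: (@cubic3_inv (fun x y z => F x y (sl_br (tnth I e) z))).
  by split=> *; [apply: F1|apply: F2|apply: linear_ad].
(* The combination of the three equations that isolates the first pair. *)
transitivity (2^-1 *: (((2 * M%:R) *: cubic3 F + P12 + P13)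
  + (P12 + (2 * M%:R) *: cubic3 F + P23)
  - (P13 + P23 + (2 * M%:R) *: cubic3 F)) - M%:R *: cubic3 F).
  by lmod_eq C; field.
by rewrite E1 E2 E3; lmod_eq C; ring.
Qed.

(** The previous contraction, with one of the contracted basis vectors moved by
    invariance of the Casimir tensor into a slot of its own. *)
Lemma cubic3_ad_double (G : sl -> sl -> sl -> V) : trilin G ->
  cubic3 (fun x y z => casimir2 (fun u u' => G u (sl_br (sl_br u' x) y) z))
  = M%:R *: cubic3 G.
Proof.
move=> GL; have [G1 G2 G3] := GL.
rewrite -[RHS]opprK -scaleNr -(cubic3_ad_ad GL) -sumrN.
transitivity (cubic3 (fun x y z => \sum_(e < d)
  - G (sl_br (tnth I e) x) (sl_br (tnth I e) y) z)).
  apply: eq_cubic3 => x y z; rewrite sumrN.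
  have GB : bilin (fun u v => G u (sl_br v y) z).
    split=> [v|u] c u' u''; first exact: G1.
    by rewrite sl_brPl; apply: G2.
  have := casimir2_inv x GB; rewrite /casimir2 => H.
  transitivity (\sum_(e < d) - G (tnth I e) (sl_br (sl_br x (tnth I e)) y) z).
    apply: eq_bigr => e _; rewrite [sl_br x _]sl_brC sl_brNl.
    by rewrite (linN (G2 _ _)) opprK.
  rewrite sumrN H opprK -sumrN; apply: eq_bigr => e _.
  by rewrite sl_brC (linN (G1 _ _)).
rewrite cubic3_sum; apply: eq_bigr => e _.
by rewrite -scaleN1r -cubic3Z; apply: eq_cubic3 => x y z; rewrite scaleN1r.
Qed.

End Contractions.

(** * Weighted modes on the vacuum module *)

Section Modes.
Variables (C : numFieldType) (M N : nat) (k : 'I_N -> C).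
Local Notation sl := (sl C M).
Local Notation V := (vacuum_module M k).
Local Notation affN := (affineN C M N).
Local Notation vac := (vacuum M k).
Implicit Types (f g h : 'rV[C]_N) (m n : int) (x y : sl) (v : V).

Lemma vacuum_module_ind (P : V -> Prop) :
  P 0 -> (forall c u v, P u -> P v -> P (c *: u + v)) ->
  P vac -> (forall (y : affN) v, P v -> P (lact y v)) -> forall v, P v.
Proof.
move=> P0 PD Pvac Pact; apply: ind_word_ind => // u.
elim: u => // y u /(Pact y); rewrite /lact act_pi prefix_word; exact.
Qed.

(** The central elements act on the whole module as on the vacuum. *)
Lemma lact_central (c : affN) v : (forall i, (c i).1 = 0) ->
  lact c v = level_char k c *: v.
Proof.
move=> c1.
have brc (y : affN) : affineN_br c y = 0.
  apply/ffunP => i; rewrite !ffunE /affine_br c1.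
  exact: (central_br (y i)).1.
have lact0 w : lact (0 : affN) w = 0 :> V.
  by apply: (lin0 (f := fun c : affN => lact c w)) => e x y; apply: lact_linearl.
elim/vacuum_module_ind: v => [|a u v IHu IHv||y u IH].
- by rewrite linear0 scaler0.
- by rewrite lact_linear IHu IHv scalerDr !scalerA mulrC.
- by apply: lact_vacuum => i n _; rewrite c1.
have /eqP := lact_br c y u; rewrite brc lact0 subr_eq0 => /eqP ->.
by rewrite IH linearZ.
Qed.

(** The element [x_n] of the affine Lie algebra with weight [f]: the sum over the
    sites [i] of [f_i] times the [i]-th copy of [x_n]. A weight, a function on the
    set of sites, is encoded as a row vector. *)
Definition opel_def f n x : affN := \sum_(i < N) f 0 i *: copy i (mode x n).

Fact op_key : unit. Proof. exact: tt. Qed.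
Definition opel := locked_with op_key opel_def.

(** The action of that element on the vacuum module. Both are locked, as their
    unfolding makes unification impracticable. *)
Definition op f n x : V -> V := locked_with op_key (fun v => lact (opel f n x) v).

Lemma opelE f n x : opel f n x = \sum_(i < N) f 0 i *: copy i (mode x n).
Proof. by rewrite /opel unlock. Qed.

Lemma opE f n x v : op f n x v = lact (opel f n x) v.
Proof. by rewrite /op unlock. Qed.

(** The level of a weight; that of the weight [1 / (z - z_i)] is the twist
    function at [z]. *)
Definition level f : C := \sum_(i < N) k i * f 0 i.

(** The pointwise product of weights. *)
Definition wmul f g : 'rV[C]_N := \row_i (f 0 i * g 0 i).

Lemma sum_copyE (f : 'I_N -> C) (A : affine C M) :
  \sum_(i < N) f i *: copy i A = [ffun i => f i *: A] :> affN.
Proof.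
apply/ffunP => i; rewrite sum_ffunE ffunE (bigD1 i) //= big1 ?addr0.
  by rewrite !ffunE eqxx.
by move=> j /negPf ji; rewrite !ffunE eq_sym ji scaler0.
Qed.

Lemma modeP c x y n : mode (c *: x + y) n = c *: mode x n + mode y n :> affine C M.
Proof.
congr pair; last by transitivity (c * 0 + 0 : C); rewrite // mulr0 addr0.
apply: finsuppP => j; rewrite finsuppE /=.
by case: (j == n); rewrite ?scaler0 ?addr0.
Qed.

Lemma modeZ c x n : mode (c *: x) n = c *: mode x n :> affine C M.
Proof.
congr pair; last by transitivity (c * 0 : C); rewrite // mulr0.
apply: finsuppP => j; rewrite -[c *: fsdelta n x]addr0 finsuppE /=.
by case: (j == n); rewrite ?scaler0 ?addr0.
Qed.

Lemma affNPE c (A B : affN) i : (c *: A + B) i = c *: A i + B i.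
Proof. by rewrite !ffunE. Qed.

Lemma opel_siteE f n x i : opel f n x i = f 0 i *: mode x n.
Proof. by rewrite opelE sum_copyE ffunE. Qed.

Lemma opelPf c f g n x : opel (c *: f + g) n x = c *: opel f n x + opel g n x.
Proof.
by apply/ffunP => i; rewrite affNPE !opel_siteE scalerA !mxE scalerDl.
Qed.

Lemma opelPx c f n x y : opel f n (c *: x + y) = c *: opel f n x + opel f n y.
Proof.
by apply/ffunP => i; rewrite affNPE !opel_siteE modeP scalerDr !scalerA mulrC.
Qed.

Lemma opPf c f g n x v : op (c *: f + g) n x v = c *: op f n x v + op g n x v.
Proof.
by rewrite !opE opelPf lact_linearl.
Qed.

Lemma opPx f n c x y v : op f n (c *: x + y) v = c *: op f n x v + op f n y v.
Proof.
by rewrite !opE opelPx lact_linearl.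
Qed.

Lemma opPv f n x c u v : op f n x (c *: u + v) = c *: op f n x u + op f n x v.
Proof. by rewrite !opE lact_linear. Qed.

Lemma opv0 f n x : op f n x 0 = 0.
Proof. by rewrite opE linear0. Qed.

Lemma op_vac f n x : 0 <= n -> op f n x vac = 0.
Proof.
move=> n0; rewrite opE lact_vacuum => [|i j j0]; last first.
  rewrite opel_siteE -modeZ /=.
  by case: eqP => // jn; move: j0; rewrite jn ltNge n0.
rewrite /level_char big1 ?scale0r // => i _.
by rewrite opel_siteE -modeZ mulr0.
Qed.

Lemma opel_br f m x g n y : affineN_br (opel f m x) (opel g n y) =
  -1 *: [ffun i => ((n%:~R * (m + n == 0)%:R * trform x y) * wmul f g 0 i)
           *: central C M]
  + opel (wmul f g) (m + n) (sl_br x y).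
Proof.
have brE (A B : affN) i : affineN_br A B i = affine_br (A i) (B i).
  by rewrite ffunE.
apply/ffunP => i; rewrite affNPE brE.
rewrite [X in _ *: X + _](_ : _ = ((n%:~R * (m + n == 0)%:R * trform x y)
    * wmul f g 0 i) *: central C M); last exact: ffunE.
rewrite (opel_siteE f) (opel_siteE g) opel_siteE mxE -(modeZ (f 0 i) x m) -(modeZ (g 0 i) y n).
have E1 : trform (f 0 i *: x) (g 0 i *: y) = trform x y * (f 0 i * g 0 i).
  rewrite -[f 0 i *: x]addr0 -[g 0 i *: y]addr0 trformPl trformPr.
  by rewrite trform0l trform0r !addr0; ring.
have E2 : sl_br (f 0 i *: x) (g 0 i *: y) = (f 0 i * g 0 i) *: sl_br x y.
  rewrite -[f 0 i *: x]addr0 -[g 0 i *: y]addr0 sl_brPl sl_brPr sl_br0l sl_br0r.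
  by rewrite !addr0 scalerA.
by rewrite mode_br E1 E2 mulrA modeZ addrC scaleN1r.
Qed.

(** The commutation relations: the weighted modes represent the central extension
    of the loop algebra of [sl_M] tensored with the functions on the sites. *)
Lemma op_comm f m x g n y v : op f m x (op g n y v) =
  op g n y (op f m x v) + op (wmul f g) (m + n) (sl_br x y) v
  - (n%:~R * (m + n == 0)%:R * trform x y * level (wmul f g)) *: v.
Proof.
apply/eqP; rewrite -addrA addrC -subr_eq; apply/eqP.
rewrite !opE lact_br opel_br lact_linearl [LHS]addrC scaleN1r.
rewrite [X in _ - X]lact_central => [|i]; last by rewrite ffunE /= scaler0.
congr (_ - _ *: _); move: (n%:~R * _ * _) => s.
rewrite /level mulr_sumr /level_char; apply: eq_bigr => i _.
transitivity (k i * (s * wmul f g 0 i * 1)); first by rewrite ffunE.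
by rewrite mulr1 mulrCA.
Qed.
End Modes.

(** * The zero mode of the quadratic states *)

Section Commutators.
Variables (C : numFieldType) (M N : nat) (k : 'I_N -> C).
Variables (d : nat) (I : d.-tuple (sl C M)).
Hypothesis I_basis : basis_of fullv I.
Hypothesis I_orth : forall a b : 'I_d, trform (tnth I a) (tnth I b) = (a == b)%:R.
Local Notation sl := (sl C M).
Local Notation V := (vacuum_module M k).
Local Notation vac := (vacuum M k).
Local Notation op := (@op C M N k).
Local Notation level := (@level C N k).
Implicit Types (f g h p q : 'rV[C]_N) (m n : int) (x y b : sl) (v : V).

Lemma op_linf n x v : linear (fun f => op f n x v).
Proof. by move=> c f g; exact: opPf. Qed.

Lemma op_linx f n v : linear (fun x => op f n x v).
Proof. by move=> c y z; exact: opPx. Qed.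

Lemma op_linv f n x : linear (op f n x).
Proof. by move=> c u v; exact: opPv. Qed.

Lemma opDv f n x u v : op f n x (u + v) = op f n x u + op f n x v.
Proof. exact: linD (op_linv f n x) u v. Qed.

Lemma opZv f n x c v : op f n x (c *: v) = c *: op f n x v.
Proof. exact: linZ (op_linv f n x) c v. Qed.

Lemma opNv f n x v : op f n x (- v) = - op f n x v.
Proof. exact: linN (op_linv f n x) v. Qed.

Lemma op_sumv f n x (J : finType) (F : J -> V) :
  op f n x (\sum_j F j) = \sum_j op f n x (F j).
Proof. exact: lin_sum (op_linv f n x) _ _ _. Qed.

Lemma opNx f n x v : op f n (- x) v = - op f n x v.
Proof. exact: linN (op_linx f n v) x. Qed.

Lemma opZf c f n x v : op (c *: f) n x v = c *: op f n x v.
Proof. exact: linZ (op_linf n x v) c f. Qed.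

Lemma opBf f g n x v : op (f - g) n x v = op f n x v - op g n x v.
Proof.
by rewrite -[- op _ _ _ _](linN (op_linf n x v)); exact: linD (op_linf n x v) f (- g).
Qed.

Lemma op_swap f m x g n y v : m + n != 0 ->
  op f m x (op g n y v) = op g n y (op f m x v) + op (wmul f g) (m + n) (sl_br x y) v.
Proof.
by move=> /negPf mn; rewrite op_comm mn mulr0 !mul0r scale0r subr0.
Qed.

(** [v] is annihilated by all modes of degree at least [n]. *)
Definition killed n v := forall f m x, n <= m -> op f m x v = 0.

Lemma killed_vac : killed 1 vac.
Proof. by move=> f m x m1; rewrite op_vac // (le_trans _ m1). Qed.

Lemma killed_op f x n v : 1 <= n -> killed n v -> killed (n + 1) (op f (-1) x v).
Proof.
move=> n1 kv g m y nm.
have m1 : m - 1 != 0 by rewrite gt_eqF // subr_gt0 (lt_le_trans _ nm) // ltzD1.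
rewrite op_swap // kv ?(le_trans _ nm) ?lerDl // opv0 add0r kv //.
by rewrite lerBrDr.
Qed.

Lemma killed_le m n v : m <= n -> killed m v -> killed n v.
Proof. by move=> mn kv f j x nj; apply: kv; apply: le_trans nj. Qed.

Lemma op_expand f n b v :
  \sum_(a < d) trform (tnth I a) b *: op f n (tnth I a) v = op f n b v.
Proof.
rewrite [in RHS](sl_expand I_basis I_orth b).
exact/esym/(lin_comb (op_linx f n v)).
Qed.

(** The zero mode of the state [quad p] below, a sum over all [j >= 0] truncated to
    its first four terms. The truncation is harmless: at most three currents are
    applied to the vacuum, so that only vectors killed by the modes of degree at
    least 4 are met. *)
Definition sugawara p v : V :=
  \sum_(j < 4) casimir2 I (fun x y => op p (-1 - j%:Z) x (op p j%:Z y v)).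

(** The terms of the commutator with [b] in which a mode of nonnegative degree is
    left to act on [v]; three terms suffice, as [v] contains at most two currents. *)
Definition tail_modes g h b v : V :=
  \sum_(j < 3) casimir2 I (fun x y => op g (-2 - j%:Z) x (op h j%:Z (sl_br y b) v)).

(** The commutator of one term of [sugawara] with a current. *)
Lemma sugawara_term p q b v (j : nat) :
  casimir2 I (fun x y => op p (-1 - j%:Z) x (op p j%:Z y (op q (-1) b v)))
  = op q (-1) b (casimir2 I (fun x y => op p (-1 - j%:Z) x (op p j%:Z y v)))
    + casimir2 I (fun x y => op p (-1 - j%:Z) x (op (wmul p q) (j%:Z - 1) (sl_br y b) v))
    - casimir2 I (fun x y => op (wmul p q) (-2 - j%:Z) x (op p j%:Z (sl_br y b) v))
    + ((j == 1%N)%:R * level (wmul p q)) *: op p (-2) b v.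
Proof.
have BL : bilin (fun x y => op (wmul p q) (-2 - j%:Z) x (op p j%:Z y v)).
  by split=> [y|x] c u u'; rewrite ?opPx // opPv.
rewrite (casimir2_invr I_basis I_orth b BL) /casimir2 op_sumv.
rewrite -(op_expand p (-2) b v) scaler_sumr opprK -!big_split.
apply: eq_bigr => a _ /=.
rewrite (op_comm p j%:Z _ q) !(opDv, opNv, opZv) (@op_swap p (-1 - j%:Z) _ q);
  last by rewrite -!opprD oppr_eq0.
rewrite [-1 - j%:Z - 1](_ : _ = -2 - j%:Z); last by ring.
rewrite subr_eq0 eqz_nat.
case: eqP => [->|_]; lmod_eq C; ring.
Qed.

(** Of the two families of bracket terms of [sugawara_term], the first is split into
    its member [j = 0], in which both modes have degree -1, and a tail; the second is
    a tail, its last member being zero since [v] is killed by modes of degree 3. *)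
Lemma sugawara_comm p q b v : killed 3 v ->
  sugawara p (op q (-1) b v) = op q (-1) b (sugawara p v)
   + casimir2 I (fun x y => op p (-1) x (op (wmul p q) (-1) (sl_br y b) v))
   + (tail_modes p (wmul p q) b v - tail_modes (wmul p q) p b v)
   + level (wmul p q) *: op p (-2) b v.
Proof.
move=> kv; rewrite /sugawara /tail_modes.
have sum4 (G : nat -> V) : \sum_(j < 4) G j = G 0%N + G 1%N + G 2%N + G 3%N.
  by rewrite !big_ord_recr big_ord0 /= add0r.
have sum3 (G : nat -> V) : \sum_(j < 3) G j = G 0%N + G 1%N + G 2%N.
  by rewrite !big_ord_recr big_ord0 /= add0r.
rewrite (sum4 (fun j => casimir2 I (fun x y =>
  op p (-1 - j%:Z) x (op p j%:Z y (op q (-1) b v))))).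
rewrite (sum4 (fun j => casimir2 I (fun x y =>
  op p (-1 - j%:Z) x (op p j%:Z y v)))).
rewrite (sum3 (fun j => casimir2 I (fun x y =>
  op p (-2 - j%:Z) x (op (wmul p q) j%:Z (sl_br y b) v)))).
rewrite (sum3 (fun j => casimir2 I (fun x y =>
  op (wmul p q) (-2 - j%:Z) x (op p j%:Z (sl_br y b) v)))).
rewrite !sugawara_term !opDv /=.
have -> : casimir2 I (fun x y =>
    op (wmul p q) (-2 - 3%:Z) x (op p 3%:Z (sl_br y b) v)) = 0.
  by rewrite /casimir2 big1 // => a _; rewrite kv // opv0.
rewrite (_ : -1 - 1%:Z = -2) // (_ : -1 - 2%:Z = -3) // (_ : -1 - 3%:Z = -4) //.
rewrite (_ : 1%:Z - 1 = 0) // (_ : 2%:Z - 1 = 1) // (_ : 3%:Z - 1 = 2) //.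
rewrite (_ : -2 - 1%:Z = -3) // (_ : -2 - 2%:Z = -4) //.
rewrite (_ : 0%:Z - 1 = -1) // (_ : -1 - 0%:Z = -1) // (_ : -2 - 0%:Z = -2) //.
lmod_eq C; ring.
Qed.

Lemma killed_sugawara_vac p : sugawara p vac = 0.
Proof.
rewrite /sugawara big1 // => j _; rewrite /casimir2 big1 // => a _.
by rewrite op_vac // opv0.
Qed.

(** For equal weights, the antisymmetry in the two currents turns their product
    into half a commutator, hence into half the adjoint Casimir operator. *)
Lemma casimir2_square p b v :
  casimir2 I (fun x y => op p (-1) x (op p (-1) (sl_br y b) v))
  = M%:R *: op (wmul p p) (-2) b v.
Proof.
have BL : bilin (fun x y => op p (-1) x (op p (-1) y v)).
  by split=> [y|x] c u u'; rewrite ?opPx // opPv.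
set L := LHS.
have : L = - L + (2 * M%:R) *: op (wmul p p) (-2) b v.
  rewrite {1}/L (casimir2_invr I_basis I_orth b BL).
  rewrite -(linear_casimir I_basis I_orth _ (op_linx (wmul p p) (-2) v)).
  rewrite /L /casimir2 -!sumrN -big_split; apply: eq_bigr => a _ /=.
  rewrite (@op_swap p _ (sl_br _ _) p) //.
  by rewrite opprD [sl_br (sl_br _ _) _]sl_brC opNx opprK.
move=> E; transitivity (2^-1 *: (L + L)); first by lmod_eq C; field.
by rewrite {2}E; lmod_eq C; field.
Qed.

Section VertexStructure.
Variables (T : V -> V) (Y : V -> int -> V -> V).
Hypothesis TY : is_vertex_structure T Y.

Lemma op_siteE f n x v :
  op f n x v = \sum_(i < N) f 0 i *: lact (copy i (mode x n)) v.
Proof.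
rewrite opE opelE.
by apply: (lin_comb (f := fun c : affineN C M N => lact c v)) => c u u';
  apply: lact_linearl.
Qed.

Lemma Y_sum (J : Type) (s : seq J) (c : J -> C) (X : J -> V) n v :
  Y (\sum_(j <- s) c j *: X j) n v = \sum_(j <- s) c j *: Y (X j) n v.
Proof. exact: (lin_comb (Y_linearl TY n v)). Qed.

Lemma Y_op f x n v : Y (op f (-1) x vac) n v = op f n x v.
Proof.
rewrite !op_siteE Y_sum; apply: eq_bigr => i _.
by rewrite (Y_mode TY).
Qed.

(** The quadratic state; [quad (wt z)] is [varsigma_1 z] and, for the weight of a
    single site, [quad] is the Segal-Sugawara state up to normalization. *)
Definition quad p : V :=
  2^-1 *: casimir2 I (fun x y => op p (-1) x (op p (-1) y vac)).

(** Both terms of the normal ordered product contribute the same sum, which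
    compensates the factor 1/2. *)
Lemma Y_quad p v : killed 4 v -> Y (quad p) 0 v = sugawara p v.
Proof.
move=> kv; rewrite /quad /casimir2 scaler_sumr Y_sum.
rewrite /sugawara /casimir2 exchange_big; apply: eq_bigr => a _ /=.
set X := op p (-1) (tnth I a) vac.
rewrite -(Y_op p (tnth I a) (-1) X) -/X (Y_normal TY (K := 4)).
  rewrite scaler_sumr; apply: eq_bigr => j _.
  rewrite /X !Y_op !add0r.
  by lmod_eq C; field.
by move=> j j4; rewrite /X !Y_op ?add0r; split; apply: kv; rewrite ?add0r lez_nat.
Qed.

Variables (p q : 'rV[C]_N) (lam : C).
Hypothesis kM : forall i, k i + M%:R != 0.
Hypothesis pq : wmul p q = lam *: (q - p).

(** The weight of a single site. *)
Definition wdelta (i : 'I_N) : 'rV[C]_N := delta_mx 0 i.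

(** The zero mode of [s_1 z], for [p] the weight at [z]. As [p_i = 1 / (z - z_i)],
    the states [omega^(i)] enter [M] times the twisted derivative of [omega] with
    the coefficients [- M p_i^2 - (level p) p_i]. *)
Definition s1_mode v : V := Y (quad p +
  \sum_(i < N) (- (M%:R * p 0 i ^+ 2 + level p * p 0 i)) *:
     ((k i + M%:R)^-1 *: quad (wdelta i))) 0 v.

Lemma s1_modeE v : killed 4 v -> s1_mode v = sugawara p v +
  \sum_(i < N) (- (M%:R * p 0 i ^+ 2 + level p * p 0 i)) *:
     ((k i + M%:R)^-1 *: sugawara (wdelta i) v).
Proof.
move=> kv; rewrite /s1_mode (linD (Y_linearl TY 0 v)) Y_quad // Y_sum.
congr (_ + _); apply: eq_bigr => i _.
by rewrite (linZ (Y_linearl TY 0 v)) Y_quad.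
Qed.

Lemma s1_mode_vac : s1_mode vac = 0.
Proof.
have kv : killed 4 vac by apply: killed_le killed_vac.
rewrite s1_modeE // killed_sugawara_vac big1 ?addr0 // => i _.
by rewrite killed_sugawara_vac !scaler0.
Qed.

Lemma s1_mode_linear : linear s1_mode.
Proof. exact: (Y_linearr TY). Qed.

(** The weight of the degree -2 mode produced by the commutator. *)
Definition s1_weight : 'rV[C]_N :=
  - (M%:R * lam ^+ 2) *: (q - p) + lam *: (level q *: p - level p *: q).

Lemma levelP c f g : level (c *: f + g) = c * level f + level g.
Proof.
rewrite /level mulr_sumr -big_split; apply: eq_bigr => i _.
by rewrite !mxE mulrDr mulrCA.
Qed.

(** The Segal-Sugawara states generate the translations of the single sites. *)
Lemma sugawara_delta i b v : killed 3 v ->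
  sugawara (wdelta i) (op q (-1) b v) = op q (-1) b (sugawara (wdelta i) v)
  + (q 0 i * (k i + M%:R)) *: op (wdelta i) (-2) b v.
Proof.
move=> kv; rewrite sugawara_comm //.
have dq : wmul (wdelta i) q = q 0 i *: wdelta i.
  by apply/rowP => j; rewrite !mxE eqxx /= mulrC; case: eqP => [->|_]; rewrite ?mulr0.
have dd : wmul (wdelta i) (wdelta i) = wdelta i.
  by apply/rowP => j; rewrite !mxE -natrM mulnb andbb.
have ld : level (wmul (wdelta i) q) = q 0 i * k i.
  rewrite dq /level (bigD1 i) //= big1 ?addr0 => [|j /negPf ji].
    by rewrite !mxE !eqxx mulr1 mulrC.
  by rewrite !mxE ji andbF !mulr0.
rewrite ld dq.
have -> : casimir2 I (fun x y =>
    op (wdelta i) (-1) x (op (q 0 i *: wdelta i) (-1) (sl_br y b) v))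
  = (q 0 i * M%:R) *: op (wdelta i) (-2) b v.
  have := casimir2_square (wdelta i) b v; rewrite dd -scalerA => <-.
  by rewrite /casimir2 scaler_sumr; apply: eq_bigr => a _; rewrite opZf opZv.
have -> : tail_modes (wdelta i) (q 0 i *: wdelta i) b v
    = tail_modes (q 0 i *: wdelta i) (wdelta i) b v.
  apply: eq_bigr => j _; apply: eq_bigr => a _.
  by rewrite !opZf opZv.
by lmod_eq C; ring.
Qed.

Lemma tail_modesPr c g f h b v :
  tail_modes g (c *: f + h) b v = c *: tail_modes g f b v + tail_modes g h b v.
Proof.
rewrite /tail_modes scaler_sumr -big_split; apply: eq_bigr => j _.
rewrite /casimir2 scaler_sumr -big_split; apply: eq_bigr => a _ /=.
by rewrite opPf opPv.
Qed.

Lemma tail_modesPl c g f h b v :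
  tail_modes (c *: f + h) g b v = c *: tail_modes f g b v + tail_modes h g b v.
Proof.
rewrite /tail_modes scaler_sumr -big_split; apply: eq_bigr => j _.
rewrite /casimir2 scaler_sumr -big_split; apply: eq_bigr => a _ /=.
by rewrite opPf.
Qed.

(** The coefficient at one site of the identity between weights used in the next
    proof; [x] and [y] stand for [p_i] and [q_i]. *)
Lemma s1_weight_coef (m l lp lq x y : C) : x * y = l * (y - x) ->
  - (m * l ^+ 2) * (y - x) + l * (lq * x - lp * y)
  = l * (lq - lp) * x - l * m * (x * x) - (m * (x * x * y) + lp * (x * y)).
Proof.
move=> E.
transitivity (l * (lq - lp) * x - m * l * (x * y) - lp * (l * (y - x))).
  by rewrite E; ring.
transitivity (l * (lq - lp) * x - l * m * x ^+ 2 - m * x * (l * (y - x))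
  - lp * (l * (y - x))); first by ring.
by rewrite -E; ring.
Qed.

(** The commutator of the zero mode of [s_1 z] with a current. The Segal-Sugawara
    part is what cancels the terms with the square of the weight [p]; those with
    [lam ^ 2] in [s1_weight] will cancel against commutators of currents. *)
Lemma s1_mode_comm b v : killed 3 v ->
  s1_mode (op q (-1) b v) = op q (-1) b (s1_mode v)
    + lam *: casimir2 I (fun x y => op p (-1) x (op q (-1) (sl_br y b) v))
    + lam *: (tail_modes p q b v - tail_modes q p b v)
    + op s1_weight (-2) b v.
Proof.
move=> kv; have kv4 : killed 4 v by apply: killed_le kv.
have k4 : killed 4 (op q (-1) b v) := @killed_op q b 3 v isT kv.
rewrite !s1_modeE // sugawara_comm // pq !opDv.
have -> : \sum_(i < N) - (M%:R * p 0 i ^+ 2 + level p * p 0 i) *: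
     ((k i + M%:R)^-1 *: sugawara (wdelta i) (op q (-1) b v))
  = op q (-1) b (\sum_(i < N) - (M%:R * p 0 i ^+ 2 + level p * p 0 i) *:
     ((k i + M%:R)^-1 *: sugawara (wdelta i) v))
   - op (M%:R *: wmul (wmul p p) q + level p *: wmul p q) (-2) b v.
  have -> : M%:R *: wmul (wmul p p) q + level p *: wmul p q
     = \sum_i ((M%:R * p 0 i ^+ 2 + level p * p 0 i) * q 0 i) *: wdelta i.
    apply/rowP => j; rewrite summxE (bigD1 j) //= big1 ?addr0.
      by rewrite /wmul !mxE !eqxx /=; ring.
    by move=> i /negPf ij; rewrite !mxE eq_sym ij andbF mulr0.
  have -> : op (\sum_i ((M%:R * p 0 i ^+ 2 + level p * p 0 i) * q 0 i) *: wdelta i) (-2) b v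
    = \sum_i ((M%:R * p 0 i ^+ 2 + level p * p 0 i) * q 0 i) *: op (wdelta i) (-2) b v.
    exact: (lin_comb (op_linf (-2) b v)).
  rewrite op_sumv -sumrB; apply: eq_bigr => i _.
  rewrite sugawara_delta // !opZv.
  by lmod_eq C; field.
have -> : casimir2 I (fun x y => op p (-1) x (op (lam *: (q - p)) (-1) (sl_br y b) v))
  = lam *: casimir2 I (fun x y => op p (-1) x (op q (-1) (sl_br y b) v))
    - (lam * M%:R) *: op (wmul p p) (-2) b v.
  rewrite -[(lam * M%:R) *: _]scalerA -casimir2_square.
  rewrite /casimir2 !scaler_sumr -sumrB.
  apply: eq_bigr => a _; rewrite opZf opBf opZv opDv opNv.
  by lmod_eq C; ring.
(* The terms with both modes of weight [p] cancel in the difference. *)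
have -> : lam *: (q - p) = lam *: q + (- lam) *: p.
  by rewrite scalerBr scaleNr.
rewrite tail_modesPl tail_modesPr.
have -> : tail_modes p (- lam *: p) b v = - lam *: tail_modes p p b v.
  by apply: (linZ (f := fun g => tail_modes p g b v)) => c f h; apply: tail_modesPr.
have -> : tail_modes (- lam *: p) p b v = - lam *: tail_modes p p b v.
  by apply: (linZ (f := fun g => tail_modes g p b v)) => c f h; apply: tail_modesPl.
have -> : op s1_weight (-2) b v =
   level (lam *: q + - lam *: p) *: op p (-2) b v
   - (lam * M%:R) *: op (wmul p p) (-2) b v
   - op (M%:R *: wmul (wmul p p) q + level p *: wmul p q) (-2) b v.
  rewrite -!opZf -!opBf; congr (op _ (-2) b v).
  have -> : level (lam *: q + - lam *: p) = lam * (level q - level p).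
    have level_lin : linear (level : _ -> C^o) by move=> c f g; apply: levelP.
    by rewrite levelP (linZ level_lin) mulrBr -mulNr.
  apply/rowP => i; have := congr1 (fun f : 'rV_N => f 0 i) pq; rewrite !mxE => E.
  exact: s1_weight_coef E.
by lmod_eq C; ring.
Qed.

End VertexStructure.
End Commutators.

(** * Contracted commutators *)

Section Contracted.
Variables (C : numFieldType) (M N : nat) (k : 'I_N -> C).
Variables (d : nat) (I : d.-tuple (sl C M)).
Hypothesis I_basis : basis_of fullv I.
Hypothesis I_orth : forall a b : 'I_d, trform (tnth I a) (tnth I b) = (a == b)%:R.
Local Notation sl := (sl C M).
Local Notation V := (vacuum_module M k).
Local Notation vac := (vacuum M k).
Local Notation op := (@op C M N k).
Local Notation level := (@level C N k).
Local Notation casimir2 := (@casimir2 C M d I V).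
Local Notation cubic3 := (@cubic3 C M d I V).
Implicit Types (f g h p q : 'rV[C]_N) (m n l : int) (x y z u t : sl) (v : V).

Lemma wmulC f g : wmul f g = wmul g f.
Proof. by apply/rowP => i; rewrite !mxE mulrC. Qed.

Lemma eq_casimir2 (F G : sl -> sl -> V) :
  (forall x y, F x y = G x y) -> casimir2 F = casimir2 G.
Proof. by move=> FG; apply: eq_bigr => a _; rewrite FG. Qed.

Lemma casimir2D (F G : sl -> sl -> V) :
  casimir2 (fun x y => F x y + G x y) = casimir2 F + casimir2 G.
Proof. by rewrite /casimir2 big_split. Qed.

Lemma sl_brxx x : sl_br x x = 0 :> sl.
Proof. by apply/val_inj; rewrite [LHS]sl_brE subrr [RHS]linear0. Qed.

Lemma opx0 f n v : op f n 0 v = 0.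
Proof. exact: lin0 (op_linx f n v). Qed.

Lemma cubic3_swap12 f m g n h l v : m + n != 0 ->
  cubic3 (fun x y z => op f m x (op g n y (op h l z v)))
  = cubic3 (fun x y z => op g n x (op f m y (op h l z v))).
Proof.
move=> mn; rewrite [RHS]cubic3C12.
rewrite -[RHS]addr0 -(@cubic3_skew12 _ _ _ I V (fun x y z =>
  op (wmul f g) (m + n) (sl_br x y) (op h l z v))) => [|x y z]; last first.
  by rewrite sl_brC opNx.
by rewrite -cubic3D; apply: eq_cubic3 => x y z; rewrite op_swap.
Qed.

Lemma cubic3_swap23 f m g n h l v : n + l != 0 ->
  cubic3 (fun x y z => op f m x (op g n y (op h l z v)))
  = cubic3 (fun x y z => op f m x (op h l y (op g n z v))).
Proof.
move=> nl; rewrite [RHS]cubic3C23.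
rewrite -[RHS]addr0 -(@cubic3_skew23 _ _ _ I V (fun x y z =>
  op f m x (op (wmul g h) (n + l) (sl_br y z) v))) => [|x y z]; last first.
  by rewrite sl_brC opNx opNv.
rewrite -cubic3D; apply: eq_cubic3 => x y z.
by rewrite -opDv (@op_swap _ _ _ _ g n y h l z v nl).
Qed.

Lemma op_swap11 f x g y v : op f (-1) x (op g (-1) y v)
  = op g (-1) y (op f (-1) x v) + op (wmul f g) (-2) (sl_br x y) v.
Proof. exact: op_swap. Qed.

Lemma trilin_op f m g n h l v :
  trilin (fun x y z => op f m x (op g n y (op h l z v))).
Proof. by split=> ? ? c u u'; rewrite ?opPx ?opPv. Qed.

(** The contribution of the terms [p_(-1) q_(-1)] of [s1_mode_comm] to the action on
    the quadratic state. Moved to the far left, the currents of weight [p] multiply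
    a sum that vanishes by invariance; only the commutators remain. *)
Lemma quadratic_part2 p q :
  casimir2 (fun x y =>
    op q (-1) x (casimir2 (fun u u' => op p (-1) u (op q (-1) (sl_br u' y) vac)))
    + casimir2 (fun u u' => op p (-1) u (op q (-1) (sl_br u' x) (op q (-1) y vac))))
  = (2 * M%:R) *: casimir2 (fun x y => op (wmul p q) (-2) x (op q (-1) y vac)).
Proof.
transitivity (\sum_(e < d) casimir2 (fun x y =>
   op p (-1) (tnth I e) (op q (-1) x (op q (-1) (sl_br (tnth I e) y) vac))
   + op (wmul q p) (-2) (sl_br x (tnth I e)) (op q (-1) (sl_br (tnth I e) y) vac)
   + op p (-1) (tnth I e) (op q (-1) (sl_br (tnth I e) x) (op q (-1) y vac)))).
  rewrite exchange_big; apply: eq_bigr => a _.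
  rewrite /casimir2 op_sumv -big_split; apply: eq_bigr => e _ /=.
  by rewrite op_swap.
transitivity (\sum_(e < d) casimir2 (fun x y =>
   op (wmul q p) (-2) (sl_br (tnth I e) (sl_br (tnth I e) x)) (op q (-1) y vac))).
  apply: eq_bigr => e _; rewrite !casimir2D.
  rewrite (casimir2_inv I_basis I_orth (F := fun x y =>
    op p (-1) (tnth I e) (op q (-1) x (op q (-1) y vac)))); last first.
    by split=> ? c u u'; rewrite ?opPx ?opPv.
  rewrite (casimir2_inv I_basis I_orth (F := fun x y =>
    op (wmul q p) (-2) (sl_br x (tnth I e)) (op q (-1) y vac))); last first.
    by split=> ? c u u'; rewrite ?sl_brPl ?opPx ?opPv.
  set A := casimir2 _; set B := casimir2 _; rewrite addrAC addNr add0r.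
  rewrite /B /casimir2 -sumrN; apply: eq_bigr => a _.
  by rewrite sl_brC opNx opprK.
rewrite exchange_big /casimir2 scaler_sumr; apply: eq_bigr => a _.
rewrite wmulC.
by rewrite (linear_casimir I_basis I_orth _ (op_linx _ _ _)).
Qed.

(** The same for the cubic state. In addition to the Casimir operator in one slot,
    worth [2 M], the commutators produce a pair of adjoint actions, worth [M]. *)
Lemma quadratic_part3 p q :
  cubic3 (fun x y z =>
    op q (-1) x (op q (-1) y
      (casimir2 (fun u u' => op p (-1) u (op q (-1) (sl_br u' z) vac))))
    + op q (-1) x
      (casimir2 (fun u u' => op p (-1) u (op q (-1) (sl_br u' y) (op q (-1) z vac))))
    + casimir2 (fun u u' => op p (-1) u
        (op q (-1) (sl_br u' x) (op q (-1) y (op q (-1) z vac)))))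
  = (3 * M%:R) *:
    cubic3 (fun x y z => op (wmul p q) (-2) x (op q (-1) y (op q (-1) z vac))).
Proof.
set R := cubic3 (fun x y z => op (wmul p q) _ _ _).
(* The three terms moved to the left, and the two kinds of commutators. *)
pose F e x y z := op p (-1) e (op q (-1) x (op q (-1) y (op q (-1) z vac))).
pose G e x y z := op (wmul q p) (-2) (sl_br x e) (op q (-1) y (op q (-1) z vac)).
pose H x y z := op q (-1) x (op (wmul q p) (-2) y (op q (-1) z vac)).
have FL e : trilin (F e).
  by split=> ? ? c u u'; rewrite /F ?opPx ?opPv.
have GL e : trilin (G e).
  by split=> ? ? c u u'; rewrite /G ?sl_brPl ?opPx ?opPv.
have HL : trilin H by apply: trilin_op.
transitivity (\sum_(e < d) (
   cubic3 (fun x y z => F (tnth I e) (sl_br (tnth I e) x) y z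
     + F (tnth I e) x (sl_br (tnth I e) y) z
     + F (tnth I e) x y (sl_br (tnth I e) z))
   + (cubic3 (fun x y z => G (tnth I e) (sl_br (tnth I e) x) y z
     + G (tnth I e) x (sl_br (tnth I e) y) z
     + G (tnth I e) x y (sl_br (tnth I e) z))
   + cubic3 (fun x y z =>
       op (wmul q p) (-2) (sl_br (tnth I e) (sl_br (tnth I e) x))
         (op q (-1) y (op q (-1) z vac)))
   - cubic3 (fun x y z => H x (sl_br (tnth I e) y) (sl_br (tnth I e) z))))).
  under eq_bigr => e _ do rewrite -scaleN1r -cubic3Z -!cubic3D.
  rewrite -cubic3_sum; apply: eq_cubic3 => x y z.
  rewrite /casimir2 !op_sumv -!big_split; apply: eq_bigr => e _ /=.
  rewrite /F /G /H scaleN1r.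
  do 2! rewrite !(op_swap11 q _ p) ?opDv.
  rewrite [sl_br (sl_br _ _) _]sl_brC [sl_br y (tnth I e)]sl_brC !opNx !opNv.
  by lmod_eq C; ring.
under eq_bigr => e _.
  rewrite (cubic3_inv I_basis I_orth _ (FL _)) (cubic3_inv I_basis I_orth _ (GL _)).
  rewrite !add0r.
  over.
rewrite sumrB (cubic3_casimir1 I_basis I_orth (F := fun x y z =>
  op (wmul q p) (-2) x (op q (-1) y (op q (-1) z vac)))); last exact: trilin_op.
have -> : \sum_(e < d) cubic3 (fun x y z =>
    H x (sl_br (tnth I e) y) (sl_br (tnth I e) z)) = - M%:R *: R.
  rewrite /R wmulC cubic3_swap12 // -/H cubic3C12 cubic3C23 /=.
  rewrite -(cubic3_ad_ad I_basis I_orth) => [|//]; last first.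
    exact: trilinC23 (trilinC12 HL).
  apply: eq_bigr => e _.
  by rewrite [LHS]cubic3C12 cubic3C23.
by rewrite /R wmulC; lmod_eq C; ring.
Qed.

Lemma modes_vac f x :
  (op f 0 x vac = 0) * (op f 1 x vac = 0) * (op f 2 x vac = 0).
Proof. by rewrite !op_vac. Qed.

Lemma mode0_op h u q y v :
  op h 0 u (op q (-1) y v) = op q (-1) y (op h 0 u v) + op (wmul h q) (-1) (sl_br u y) v.
Proof. exact: op_swap. Qed.

Lemma mode1_op h u q y v : op h 1 u (op q (-1) y v) =
  op q (-1) y (op h 1 u v) + op (wmul h q) 0 (sl_br u y) v
  + (trform u y * level (wmul h q)) *: v.
Proof. by rewrite op_comm subrr eqxx mulr1 !mulN1r mulNr scaleNr opprK. Qed.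

Lemma mode2_op h u q y v :
  op h 2 u (op q (-1) y v) = op q (-1) y (op h 2 u v) + op (wmul h q) 1 (sl_br u y) v.
Proof. exact: op_swap. Qed.

Lemma tail_modesE g h x v : tail_modes I g h x v =
  casimir2 (fun u u' => op g (-2) u (op h 0 (sl_br u' x) v))
  + casimir2 (fun u u' => op g (-3) u (op h 1 (sl_br u' x) v))
  + casimir2 (fun u u' => op g (-4) u (op h 2 (sl_br u' x) v)).
Proof.
have sum3 (G : nat -> V) : \sum_(j < 3) G j = G 0%N + G 1%N + G 2%N.
  by rewrite !big_ord_recr big_ord0 /= add0r.
exact: (sum3 (fun j => casimir2 (fun u u' =>
  op g (-2 - j%:Z) u (op h j%:Z (sl_br u' x) v)))).
Qed.

Lemma tail_modes_vac g h x : tail_modes I g h x vac = 0.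
Proof.
rewrite tail_modesE /casimir2 -!big_split big1 // => a _ /=.
by rewrite !op_vac // !opv0 !addr0.
Qed.

Lemma tail_modes_op1 g h q x y : tail_modes I g h x (op q (-1) y vac) =
  casimir2 (fun u u' => op g (-2) u (op (wmul h q) (-1) (sl_br (sl_br u' x) y) vac))
  + level (wmul h q) *: op g (-3) (sl_br x y) vac.
Proof.
rewrite tail_modesE -[in RHS](op_expand I_basis I_orth g (-3)) scaler_sumr.
rewrite /casimir2 -!big_split; apply: eq_bigr => a _ /=.
rewrite mode0_op mode1_op mode2_op !modes_vac !opv0 !add0r.
by rewrite opv0 addr0 opZv scalerA mulrC trform_inv.
Qed.

(** Of the terms with a mode of nonnegative degree only the one of degree 0 acts
    nontrivially once contracted, through the Casimir operator. *)
Lemma tail_modes2 g h q :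
  casimir2 (fun x y => tail_modes I g h x (op q (-1) y vac))
  = (2 * M%:R) *: casimir2 (fun x y => op g (-2) x (op (wmul h q) (-1) y vac)).
Proof.
transitivity (casimir2 (fun x y => \sum_(e < d) op g (-2) (tnth I e)
    (op (wmul h q) (-1) (sl_br x (sl_br y (tnth I e))) vac))).
  apply: eq_bigr => a _; rewrite tail_modes_op1 sl_brxx opx0 scaler0 addr0.
  apply: eq_bigr => e _; congr (op _ _ _ _).
  by rewrite sl_brC [sl_br (tnth I e) _]sl_brC sl_brNr opprK.
rewrite /casimir2 [RHS]scaler_sumr exchange_big; apply: eq_bigr => e _.
rewrite -op_sumv -opZv.
by rewrite (linear_casimir I_basis I_orth _ (op_linx _ _ _)).
Qed.

(** Apart from [G0] and its mirror image [G0'], where a mode of degree 0 has acted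
    on one of the two currents, all terms vanish: the central term of a mode of
    degree 1 and [G1] by antisymmetry, [G2] by tracelessness of the cubic form. *)
Lemma tail_modes3l g h q :
  cubic3 (fun x y z => tail_modes I g h x (op q (-1) y (op q (-1) z vac)))
  = (2 * M%:R) *:
    cubic3 (fun x y z => op g (-2) x (op (wmul h q) (-1) y (op q (-1) z vac))).
Proof.
pose lhq := level (wmul h q); pose lhqq := level (wmul (wmul h q) q).
pose G0 u t z := op g (-2) u (op (wmul h q) (-1) t (op q (-1) z vac)).
pose G0' u t z := op g (-2) u (op q (-1) z (op (wmul h q) (-1) t vac)).
pose G1 u t z := op g (-3) u (op (wmul (wmul h q) q) (-1) (sl_br t z) vac).
pose G2 u t z := (trform t z * lhqq) *: op g (-4) u vac.
have GL0 : trilin G0 by apply: trilin_op.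
have GL0' : trilin G0' by apply: (trilinC23 (trilin_op _ _ _ _ _ _ _)).
have GL1 : trilin G1.
  by split=> ? ? c u u'; rewrite /G1 ?sl_brPl ?sl_brPr ?opPx ?opPv.
have GL2 : trilin G2.
  split=> ? ? c u u'; rewrite /G2 ?trformPl ?trformPr ?opPx; lmod_eq C; ring.
transitivity (cubic3 (fun x y z =>
    casimir2 (fun u u' => G0 u (sl_br (sl_br u' x) y) z)
    + casimir2 (fun u u' => G0' u (sl_br (sl_br u' x) z) y)
    + casimir2 (fun u u' => G1 u (sl_br (sl_br u' x) y) z)
    + lhq *: op g (-3) (sl_br x y) (op q (-1) z vac)
    + lhq *: op g (-3) (sl_br x z) (op q (-1) y vac)
    + casimir2 (fun u u' => G2 u (sl_br (sl_br u' x) y) z))).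
  apply: eq_cubic3 => x y z; rewrite tail_modesE.
  rewrite -!(op_expand I_basis I_orth g (-3)) !scaler_sumr.
  rewrite /casimir2 -!big_split; apply: eq_bigr => a _ /=.
  rewrite /G0 /G0' /G1 /G2 -/lhq !(mode0_op, mode1_op, mode2_op).
  rewrite !(modes_vac, opv0, add0r, addr0).
  rewrite !(opDv, opZv) -!trform_inv -/lhq -/lhqq.
  by lmod_eq C; ring.
rewrite !cubic3D !(cubic3_ad_double I_basis I_orth) // !cubic3Z.
rewrite (cubic3C23 I (fun x y z =>
    casimir2 (fun u u' => G0' u (sl_br (sl_br u' x) z) y))).
rewrite (cubic3_ad_double I_basis I_orth) //.
have -> : cubic3 G1 = 0.
  by apply: cubic3_skew23 => x y z; rewrite /G1 sl_brC opNx opNv.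
have -> : cubic3 G2 = 0.
  rewrite cubic3C12 cubic3C23 cubic3C12 /G2.
  under eq_cubic3 => x y z do rewrite mulrC -scalerA.
  rewrite cubic3Z.
  have := cubic3_trace I_basis I_orth (fun z => op g (-4) z vac).
  rewrite cubic3C12.
  by move=> ->; rewrite scaler0.
have -> : cubic3 (fun x y z => op g (-3) (sl_br x y) (op q (-1) z vac)) = 0.
  by apply: cubic3_skew12 => x y z; rewrite sl_brC opNx.
have -> : cubic3 (fun x y z => op g (-3) (sl_br x z) (op q (-1) y vac)) = 0.
  rewrite cubic3C23.
  by apply: cubic3_skew12 => x y z; rewrite sl_brC opNx.
have -> : cubic3 G0' = cubic3 G0 by rewrite cubic3C23 /G0' cubic3_swap23.
by lmod_eq C; ring.
Qed.

Lemma tail_modes3r g h q :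
  cubic3 (fun x y z => op q (-1) x (tail_modes I g h y (op q (-1) z vac)))
  = M%:R *:
    cubic3 (fun x y z => op g (-2) x (op (wmul h q) (-1) y (op q (-1) z vac))).
Proof.
pose G u t z := op q (-1) z (op g (-2) u (op (wmul h q) (-1) t vac)).
have GL : trilin G.
  by split=> ? ? c u u'; rewrite /G ?opPx ?opPv.
transitivity (cubic3 (fun x y z =>
    casimir2 (fun u u' => G u (sl_br (sl_br u' y) z) x)
    + level (wmul h q) *: op q (-1) x (op g (-3) (sl_br y z) vac))).
  apply: eq_cubic3 => x y z; rewrite tail_modes_op1 opDv opZv; congr (_ + _).
  by rewrite /casimir2 op_sumv.
rewrite cubic3D cubic3Z.
have -> : cubic3 (fun x y z => op q (-1) x (op g (-3) (sl_br y z) vac)) = 0.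
  by apply: cubic3_skew23 => x y z; rewrite sl_brC opNx opNv.
rewrite scaler0 addr0 cubic3C12 cubic3C23.
rewrite (cubic3_ad_double I_basis I_orth GL); congr (_ *: _).
rewrite /G cubic3C23 cubic3C12 [LHS]cubic3_swap12 //.
by rewrite [LHS]cubic3_swap23.
Qed.
End Contracted.

(** * Action on the quadratic and the cubic states *)

Section ZeroMode.
Variables (C : numFieldType) (M N : nat) (k : 'I_N -> C).
Variables (d : nat) (I : d.-tuple (sl C M)).
Hypothesis I_basis : basis_of fullv I.
Hypothesis I_orth : forall a b : 'I_d, trform (tnth I a) (tnth I b) = (a == b)%:R.
Local Notation sl := (sl C M).
Local Notation V := (vacuum_module M k).
Local Notation vac := (vacuum M k).
Local Notation op := (@op C M N k).
Local Notation level := (@level C N k).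
Local Notation casimir2 := (@casimir2 C M d I V).
Local Notation cubic3 := (@cubic3 C M d I V).
Implicit Types (f g h : 'rV[C]_N) (m n l : int) (x y z u t : sl) (v : V).

(** The states [f_m I^a g_n I^a] and [t_abc f_m I^a g_n I^b h_l I^c], with weights
    [f], [g], [h]. *)
Definition W2 f m g n : V := casimir2 (fun x y => op f m x (op g n y vac)).
Definition W3 f m g n h l : V :=
  cubic3 (fun x y z => op f m x (op g n y (op h l z vac))).

Lemma linear_casimir2 (f : V -> V) (F : sl -> sl -> V) : linear f ->
  f (casimir2 F) = casimir2 (fun x y => f (F x y)).
Proof. by move=> fL; rewrite /casimir2 (lin_sum fL). Qed.

Lemma linear_cubic3 (f : V -> V) (F : sl -> sl -> sl -> V) : linear f ->
  f (cubic3 F) = cubic3 (fun x y z => f (F x y z)).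
Proof.
move=> fL; rewrite /cubic3 (lin_sum fL); apply: eq_bigr => a _.
rewrite (lin_sum fL); apply: eq_bigr => b _.
by rewrite (lin_sum fL); apply: eq_bigr => c _; rewrite (linZ fL).
Qed.

Lemma W2_lin1 m g n : linear (fun f => W2 f m g n).
Proof.
move=> c f f'; rewrite /W2 /casimir2 scaler_sumr -big_split.
by apply: eq_bigr => a _; rewrite opPf.
Qed.

Lemma W2_lin2 f m n : linear (fun g => W2 f m g n).
Proof.
move=> c g g'; rewrite /W2 /casimir2 scaler_sumr -big_split.
by apply: eq_bigr => a _; rewrite opPf opPv.
Qed.

Lemma W3_lin1 m g n h l : linear (fun f => W3 f m g n h l).
Proof.
move=> c f f'; rewrite /W3 -cubic3Z -cubic3D.
by apply: eq_cubic3 => x y z; rewrite opPf.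
Qed.

Lemma W3_lin2 f m n h l : linear (fun g => W3 f m g n h l).
Proof.
move=> c g g'; rewrite /W3 -cubic3Z -cubic3D.
by apply: eq_cubic3 => x y z; rewrite opPf opPv.
Qed.

Lemma W3_lin3 f m g n l : linear (fun h => W3 f m g n h l).
Proof.
move=> c h h'; rewrite /W3 -cubic3Z -cubic3D.
by apply: eq_cubic3 => x y z; rewrite opPf !opPv.
Qed.

Lemma W2C f m g n : m + n != 0 -> W2 f m g n = W2 g n f m.
Proof.
by move=> mn; apply: eq_bigr => a _; rewrite op_swap // sl_brxx opx0 addr0.
Qed.

Lemma W3C12 f m g n h l : m + n != 0 -> W3 f m g n h l = W3 g n f m h l.
Proof. exact: cubic3_swap12. Qed.

Lemma W3C23 f m g n h l : n + l != 0 -> W3 f m g n h l = W3 f m h l g n.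
Proof. exact: cubic3_swap23. Qed.

Variables (T : V -> V) (Y : V -> int -> V -> V).
Hypothesis TY : is_vertex_structure T Y.

Lemma T_op f n x v :
  T (op f n x v) = op f n x (T v) + (- n)%:~R *: op f (n - 1) x v.
Proof.
rewrite !op_siteE (lin_comb (T_linear TY)) scaler_sumr -big_split.
apply: eq_bigr => i _ /=.
have /eqP := T_mode TY i x n v; rewrite subr_eq => /eqP ->.
by lmod_eq C; ring.
Qed.

Lemma T_op1 f x v : T (op f (-1) x v) = op f (-1) x (T v) + op f (-2) x v.
Proof. by rewrite T_op opprK scale1r. Qed.

Lemma T_W2 f g : T (W2 f (-1) g (-1)) = W2 f (-2) g (-1) + W2 g (-2) f (-1).
Proof.
rewrite /W2 (linear_casimir2 _ (T_linear TY)) -/(W2 g (-2) f (-1)) -W2C //.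
rewrite /W2 -casimir2D; apply: eq_casimir2 => x y.
by rewrite !T_op1 (T_vacuum TY) opv0 add0r addrC.
Qed.

Lemma T_W3 f g : T (W3 f (-1) g (-1) g (-1)) =
  W3 f (-2) g (-1) g (-1) + 2 *: W3 g (-2) f (-1) g (-1).
Proof.
rewrite {1}/W3 (linear_cubic3 _ (T_linear TY)).
transitivity (W3 f (-2) g (-1) g (-1) + W3 f (-1) g (-2) g (-1)
   + W3 f (-1) g (-1) g (-2)).
  rewrite /W3 -!cubic3D; apply: eq_cubic3 => x y z.
  by rewrite !T_op1 (T_vacuum TY) opv0 add0r !opDv; lmod_eq C; ring.
rewrite [X in _ + X]W3C23 // ![W3 f (-1) g (-2) g (-1)]W3C12 //.
by lmod_eq C; ring.
Qed.

Variables (p q : 'rV[C]_N) (lam : C).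
Hypothesis kM : forall i, k i + M%:R != 0.
Hypothesis pq : wmul p q = lam *: (q - p).
Local Notation s1_mode_comm := (s1_mode_comm I_basis I_orth TY kM pq).
Local Notation s1_weight := (@s1_weight C M N k p q lam).

Lemma s1_mode_W2 : s1_mode I Y p (W2 q (-1) q (-1)) =
  (2 * M%:R * lam) *: W2 (wmul p q) (-2) q (-1)
  + (2 * M%:R * lam) *: (W2 p (-2) (wmul q q) (-1) - W2 q (-2) (wmul p q) (-1))
  + 2 *: W2 s1_weight (-2) q (-1).
Proof.
have k3 : killed 3 vac by apply: killed_le (@killed_vac _ _ _ k).
have k3' y : killed 3 (op q (-1) y vac).
  by apply: (killed_le (m := 2)) => //; apply: (@killed_op _ _ _ _ q y 1) => //;
    exact: killed_vac.
rewrite {1}/W2 (linear_casimir2 _ (s1_mode_linear _ TY _)).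
transitivity (casimir2 (fun x y =>
  lam *: (op q (-1) x (casimir2 (fun u u' => op p (-1) u (op q (-1) (sl_br u' y) vac)))
    + casimir2 (fun u u' => op p (-1) u (op q (-1) (sl_br u' x) (op q (-1) y vac))))
  + lam *: (tail_modes I p q x (op q (-1) y vac) - tail_modes I q p x (op q (-1) y vac))
  + op q (-1) x (op s1_weight (-2) y vac) + op s1_weight (-2) x (op q (-1) y vac))).
  apply: eq_casimir2 => x y; rewrite !s1_mode_comm // (s1_mode_vac I TY) !tail_modes_vac.
  by rewrite !(opDv, opZv, opv0, oppr0, addr0, subr0, scaler0); lmod_eq C; ring.
rewrite !casimir2D.
have c2Z c (F : sl -> sl -> V) : casimir2 (fun x y => c *: F x y) = c *: casimir2 F.
  by rewrite /casimir2 scaler_sumr.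
have c2N (F : sl -> sl -> V) : casimir2 (fun x y => - F x y) = - casimir2 F.
  by rewrite /casimir2 sumrN.
rewrite !c2Z (quadratic_part2 k I_basis I_orth p q) casimir2D c2N !tail_modes2 //.
rewrite -/(W2 q (-1) s1_weight (-2)) W2C // /W2.
by lmod_eq C; ring.
Qed.

Lemma s1_mode_W3 : s1_mode I Y p (W3 q (-1) q (-1) q (-1)) =
  (3 * M%:R * lam) *: W3 (wmul p q) (-2) q (-1) q (-1)
  + (3 * M%:R * lam) *: (W3 p (-2) (wmul q q) (-1) q (-1)
                         - W3 q (-2) (wmul p q) (-1) q (-1))
  + 3 *: W3 s1_weight (-2) q (-1) q (-1).
Proof.
have k2 y : killed 2 (op q (-1) y vac).
  by apply: (@killed_op _ _ _ _ q y 1) => //; exact: killed_vac.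
have k3 : killed 3 vac by apply: killed_le (@killed_vac _ _ _ k).
have k3' y : killed 3 (op q (-1) y vac) by apply: killed_le (k2 y).
have k3'' x y : killed 3 (op q (-1) x (op q (-1) y vac)).
  exact: (@killed_op _ _ _ _ q x 2).
rewrite {1}/W3 (linear_cubic3 _ (s1_mode_linear _ TY _)).
transitivity (cubic3 (fun x y z =>
  lam *: (op q (-1) x (op q (-1) y
      (casimir2 (fun u u' => op p (-1) u (op q (-1) (sl_br u' z) vac))))
    + op q (-1) x
      (casimir2 (fun u u' => op p (-1) u (op q (-1) (sl_br u' y) (op q (-1) z vac))))
    + casimir2 (fun u u' => op p (-1) u
        (op q (-1) (sl_br u' x) (op q (-1) y (op q (-1) z vac)))))
  + lam *: (tail_modes I p q x (op q (-1) y (op q (-1) z vac)))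
  + (- lam) *: tail_modes I q p x (op q (-1) y (op q (-1) z vac))
  + lam *: (op q (-1) x (tail_modes I p q y (op q (-1) z vac)))
  + (- lam) *: (op q (-1) x (tail_modes I q p y (op q (-1) z vac)))
  + op q (-1) x (op q (-1) y (op s1_weight (-2) z vac))
  + op q (-1) x (op s1_weight (-2) y (op q (-1) z vac))
  + op s1_weight (-2) x (op q (-1) y (op q (-1) z vac)))).
  apply: eq_cubic3 => x y z; rewrite !s1_mode_comm // (s1_mode_vac I TY) !tail_modes_vac.
  by rewrite !(opDv, opNv, opZv, opv0, oppr0, addr0, subr0, scaler0); lmod_eq C; ring.
rewrite !cubic3D !cubic3Z !tail_modes3l // !tail_modes3r //.
rewrite (quadratic_part3 k I_basis I_orth p q).
rewrite -/(W3 q (-1) q (-1) s1_weight (-2)) -/(W3 q (-1) s1_weight (-2) q (-1)).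
rewrite [W3 q (-1) q (-1) s1_weight (-2)]W3C23 //.
rewrite ![W3 q (-1) s1_weight (-2) q (-1)]W3C12 //.
by rewrite /W3; lmod_eq C; ring.
Qed.
End ZeroMode.

(** * Derivatives of rational vector-valued functions *)

Section Derivatives.
Variables (C : numFieldType).

Lemma is_derive_invB (a x : C) : x != a ->
  is_derive (x : C^o) 1 (fun t : C^o => (t - a)^-1 : C^o) (- (x - a) ^- 2).
Proof.
move=> xa; have xa0 : x - a != 0 by rewrite subr_eq0.
have dB : is_derive (x : C^o) 1 (fun t : C^o => t - a : C^o) 1.
  apply: is_derive_eq (is_deriveB (is_derive_id _ _) (is_derive_cst a _ _)) _.
  by rewrite subr0.
apply: DeriveDef; first by apply: derivableV; [|apply: ex_derive].
by rewrite deriveV // derive_val; apply: mulr1.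
Qed.

(** A linear combination of fixed vectors, indexed by any finite type, is
    differentiated coefficientwise. *)
Lemma is_vderive_sum (V : lmodType C) (J : finType) (c : J -> C^o -> C^o)
    (dc : J -> C) (e : J -> V) (f : C -> V) (x : C) :
  (forall t, f t = \sum_j c j t *: e j) ->
  (forall j, is_derive (x : C^o) 1 (c j) (dc j)) ->
  is_vderive f x (\sum_j dc j *: e j).
Proof.
move=> fE dcP.
exists #|J|, (c \o enum_val), (dc \o enum_val), (e \o enum_val); split.
- by near=> t; rewrite fE (big_enum_val (A := J)).
- by move=> j; apply: dcP.
- by rewrite (big_enum_val (A := J)).
Unshelve. all: by end_near. Qed.

Lemma vderive_sum (V : lmodType C) (J : finType) (c : J -> C^o -> C^o)
    (dc : J -> C) (e : J -> V) (f : C -> V) (x : C) :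
  (forall t, f t = \sum_j c j t *: e j) ->
  (forall j, is_derive (x : C^o) 1 (c j) (dc j)) ->
  vderive f x = \sum_j dc j *: e j.
Proof. by move=> fE dcP; apply: vderiveE; apply: is_vderive_sum. Qed.
End Derivatives.

(** * Rational currents and comparison of the two sides *)

Section Assembly.
Variables (C : numFieldType) (M N : nat) (zs k : 'I_N -> C).
Variables (d : nat) (I : d.-tuple (sl C M)).
Hypothesis I_basis : basis_of fullv I.
Hypothesis I_orth : forall a b : 'I_d, trform (tnth I a) (tnth I b) = (a == b)%:R.
Local Notation sl := (sl C M).
Local Notation V := (vacuum_module M k).
Local Notation vac := (vacuum M k).
Local Notation op := (@op C M N k).
Local Notation level := (@level C N k).
Local Notation W2 := (@W2 C M N k d I).
Local Notation W3 := (@W3 C M N k d I).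

(** The weight of the rational current at [z]. *)
Definition wt (z : C) : 'rV[C]_N := \row_i (z - zs i)^-1.

Lemma IopE a n z (v : V) : Iop zs I a n z v = op (wt z) n (tnth I a) v.
Proof.
rewrite opE opelE /Iop /eval; congr (lact _ v); apply: eq_bigr => i _.
by rewrite mxE.
Qed.

Lemma twistE z : twist zs k z = level (wt z).
Proof. by apply: eq_bigr => i _; rewrite mxE. Qed.

(** The partial fraction identity. *)
Lemma wtM z w : (forall i, z != zs i) -> (forall i, w != zs i) -> z != w ->
  wmul (wt z) (wt w) = (z - w)^-1 *: (wt w - wt z).
Proof.
move=> zz ww zw; apply/rowP => i; rewrite !mxE; field.
by rewrite !subr_eq0 zz ww zw.
Qed.

Lemma wt_sum z : wt z = \sum_i (z - zs i)^-1 *: wdelta C i.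
Proof.
apply/rowP => j; rewrite summxE (bigD1 j) //= big1 ?addr0 => [|i /negPf ij].
  by rewrite !mxE !eqxx mulr1.
by rewrite !mxE eq_sym ij andbF mulr0.
Qed.

Lemma wt_sq z : wmul (wt z) (wt z) = \sum_i (z - zs i) ^- 2 *: wdelta C i.
Proof.
apply/rowP => j; rewrite summxE (bigD1 j) //= big1 ?addr0 => [|i /negPf ij].
  by rewrite !mxE !eqxx mulr1 -invfM.
by rewrite !mxE eq_sym ij andbF mulr0.
Qed.

Lemma varsigma1E z : varsigma1 zs k I z = 2^-1 *: W2 (wt z) (-1) (wt z) (-1).
Proof. by congr (_ *: _); apply: eq_bigr => a _; rewrite !IopE. Qed.

Lemma varsigma2E z :
  varsigma2 zs k I z = 3^-1 *: W3 (wt z) (-1) (wt z) (-1) (wt z) (-1).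
Proof.
by congr (_ *: _); do 3! (apply: eq_bigr => ? _); rewrite !IopE.
Qed.

Lemma A11E z w : A11 zs k I z w = (M%:R / (z - w)) *: W2 (wt z) (-2) (wt w) (-1).
Proof. by congr (_ *: _); apply: eq_bigr => a _; rewrite !IopE. Qed.

Lemma B11E z w :
  B11 zs k I z w = (M%:R / (z - w) ^+ 2) *: W2 (wt z) (-1) (wt w) (-1).
Proof. by congr (_ *: _); apply: eq_bigr => a _; rewrite !IopE. Qed.

Lemma A12E z w : A12 zs k I z w
  = (M%:R / (2 * (z - w))) *: W3 (wt z) (-2) (wt w) (-1) (wt w) (-1).
Proof. by congr (_ *: _); do 3! (apply: eq_bigr => ? _); rewrite !IopE. Qed.

Lemma B12E z w : B12 zs k I z w
  = (M%:R / (2 * (z - w) ^+ 2)) *: W3 (wt z) (-1) (wt w) (-1) (wt w) (-1).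
Proof. by congr (_ *: _); do 3! (apply: eq_bigr => ? _); rewrite !IopE. Qed.

Lemma op_wdelta i n x (v : V) : op (wdelta C i) n x v = lact (copy i (mode x n)) v.
Proof.
rewrite op_siteE (bigD1 i) //= big1 ?addr0 => [|j /negPf ji].
  by rewrite mxE !eqxx scale1r.
by rewrite mxE ji andbF scale0r.
Qed.

Lemma omega_siteE i : omega_site k I i = (k i + M%:R)^-1 *: quad k I (wdelta C i).
Proof.
rewrite /omega_site /quad scalerA invfM mulrC; congr (_ *: _).
by apply: eq_bigr => a _; rewrite !op_wdelta.
Qed.

Lemma vderive_omega z : (forall i, z != zs i) ->
  vderive (omega zs k I) z = \sum_i (- (z - zs i) ^- 2) *: omega_site k I i.
Proof.
move=> zz; apply: (vderive_sum (c := fun i t => (t - zs i)^-1)) => // i.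
exact: is_derive_invB.
Qed.

Lemma s1E z : M%:R != 0 :> C -> (forall i, z != zs i) -> s1 zs k I z =
  quad k I (wt z) + \sum_i (- (M%:R * wt z 0 i ^+ 2 + level (wt z) * wt z 0 i)) *:
     ((k i + M%:R)^-1 *: quad k I (wdelta C i)).
Proof.
move=> M0 zz; rewrite /s1 varsigma1E; congr (_ + _).
rewrite /tderive vderive_omega // twistE /omega scaler_sumr -sumrB scaler_sumr.
apply: eq_bigr => i _; rewrite -omega_siteE !mxE.
by lmod_eq C; field; rewrite M0 subr_eq0 zz.
Qed.

Lemma is_derive_pole (z w a : C) : z != w -> w != a ->
  is_derive (w : C^o) 1 (fun t : C^o => (z - t)^-1 * (t - a)^-1 : C^o)
    ((z - w) ^- 2 * (w - a)^-1 - (z - w)^-1 * (w - a) ^- 2).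
Proof.
move=> zw wa.
rewrite (_ : (fun t => _) =
  (- 1) \*: ((fun t : C^o => (t - z)^-1 : C^o) * (fun t : C^o => (t - a)^-1 : C^o)));
  last first.
  apply/funext => t; transitivity (-1 * ((t - z)^-1 * (t - a)^-1)) => //.
  by rewrite mulN1r -opprB invrN mulNr.
apply: is_derive_eq.
  apply: is_deriveZ; apply: is_deriveM; apply: is_derive_invB => //.
  by rewrite eq_sym.
(* Scaling in the regular module, as given by the derivation rules, is
   multiplication. *)
change (-1 * ((w - z)^-1 * - (w - a) ^- 2 + (w - a)^-1 * - (w - z) ^- 2)
  = (z - w) ^- 2 * (w - a)^-1 - (z - w)^-1 * (w - a) ^- 2).
by field; rewrite !subr_eq0 zw wa eq_sym zw.
Qed.

Lemma vderive_A11 z w : z != w -> (forall i, w != zs i) ->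
  vderive (fun t => A11 zs k I z t) w =
  (M%:R / (z - w) ^+ 2) *: W2 (wt z) (-2) (wt w) (-1)
  - (M%:R / (z - w)) *: W2 (wt z) (-2) (wmul (wt w) (wt w)) (-1).
Proof.
move=> zw ww.
apply: etrans (vderive_sum (c := fun i t => M%:R * ((z - t)^-1 * (t - zs i)^-1))
  (dc := fun i => M%:R * ((z - w) ^- 2 * (w - zs i)^-1 - (z - w)^-1 * (w - zs i) ^- 2))
  (e := fun i => W2 (wt z) (-2) (wdelta C i) (-1)) _ _) _.
- move=> t; rewrite A11E [wt t]wt_sum (lin_comb (W2_lin2 k I _ _ _)) scaler_sumr.
  by apply: eq_bigr => i _; rewrite scalerA mulrA.
- move=> i; apply: is_derive_eq.
    by apply: is_deriveZ; apply: is_derive_pole.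
  by [].
- rewrite [in RHS]wt_sq [X in W2 _ _ X _]wt_sum.
  rewrite !(lin_comb (W2_lin2 k I _ _ _)) !scaler_sumr -sumrB.
  by apply: eq_bigr => i _; lmod_eq C; ring.
Qed.

Lemma vderive_scaled (v : V) z w : z != w ->
  vderive (fun t => (M%:R / (t - w)) *: v) z = (- (M%:R / (z - w) ^+ 2)) *: v.
Proof.
move=> zw.
apply: etrans (vderive_sum (J := 'I_1) (c := fun i t => M%:R * (t - w)^-1)
  (dc := fun i => M%:R * - (z - w) ^- 2) (e := fun i => v) _ _) _.
- by move=> t; rewrite big_ord1.
- move=> i; apply: is_derive_eq.
    by apply: is_deriveZ; apply: is_derive_invB.
  by [].
- by rewrite big_ord1 mulrN.
Qed.

Lemma is_derive_pole2 (z w a b : C) : z != w -> w != a -> w != b ->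
  is_derive (w : C^o) 1
    (fun t : C^o => (z - t)^-1 * (t - a)^-1 * (t - b)^-1 : C^o)
    ((z - w) ^- 2 * (w - a)^-1 * (w - b)^-1
     - (z - w)^-1 * (w - a) ^- 2 * (w - b)^-1
     - (z - w)^-1 * (w - a)^-1 * (w - b) ^- 2).
Proof.
move=> zw wa wb.
apply: is_derive_eq.
  apply: (@is_deriveM _ _ (fun t : C^o => (z - t)^-1 * (t - a)^-1 : C^o)
    (fun t : C^o => (t - b)^-1 : C^o)).
    exact: is_derive_pole.
  exact: is_derive_invB.
change ((z - w)^-1 * (w - a)^-1 * - (w - b) ^- 2
  + (w - b)^-1 * ((z - w) ^- 2 * (w - a)^-1 - (z - w)^-1 * (w - a) ^- 2)
  = (z - w) ^- 2 * (w - a)^-1 * (w - b)^-1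
     - (z - w)^-1 * (w - a) ^- 2 * (w - b)^-1
     - (z - w)^-1 * (w - a)^-1 * (w - b) ^- 2).
by field; rewrite !subr_eq0 zw wa wb.
Qed.

Lemma vderive_A12 z w : z != w -> (forall i, w != zs i) ->
  vderive (fun t => A12 zs k I z t) w =
  (M%:R / (2 * (z - w) ^+ 2)) *: W3 (wt z) (-2) (wt w) (-1) (wt w) (-1)
  - (M%:R / (z - w)) *: W3 (wt z) (-2) (wmul (wt w) (wt w)) (-1) (wt w) (-1).
Proof.
move=> zw ww.
have W3_pairs (c c' : 'I_N -> C) :
    W3 (wt z) (-2) (\sum_i c i *: wdelta C i) (-1) (\sum_i c' i *: wdelta C i) (-1)
    = \sum_(ij : 'I_N * 'I_N) (c ij.1 * c' ij.2) *:
        W3 (wt z) (-2) (wdelta C ij.1) (-1) (wdelta C ij.2) (-1).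
  rewrite (lin_comb (W3_lin2 k I _ _ _ _ _)).
  rewrite -(pair_bigA _ (fun i j => (c i * c' j) *:
        W3 (wt z) (-2) (wdelta C i) (-1) (wdelta C j) (-1))) /=.
  apply: eq_bigr => i _; rewrite (lin_comb (W3_lin3 k I _ _ _ _ _)) scaler_sumr.
  by apply: eq_bigr => j _; rewrite scalerA.
apply: etrans (vderive_sum (J := ('I_N * 'I_N)%type)
  (c := fun ij t => (M%:R / 2) * ((z - t)^-1 * (t - zs ij.1)^-1 * (t - zs ij.2)^-1))
  (dc := fun ij => (M%:R / 2) * ((z - w) ^- 2 * (w - zs ij.1)^-1 * (w - zs ij.2)^-1
     - (z - w)^-1 * (w - zs ij.1) ^- 2 * (w - zs ij.2)^-1
     - (z - w)^-1 * (w - zs ij.1)^-1 * (w - zs ij.2) ^- 2))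
  (e := fun ij => W3 (wt z) (-2) (wdelta C ij.1) (-1) (wdelta C ij.2) (-1)) _ _) _.
- move=> t; rewrite A12E [wt t]wt_sum W3_pairs scaler_sumr.
  by apply: eq_bigr => ij _; rewrite scalerA invfM; congr (_ *: _); ring.
- move=> ij; apply: is_derive_eq.
    by apply: is_deriveZ; apply: is_derive_pole2.
  by [].
have two : (2 : C) != 0 by rewrite pnatr_eq0.
transitivity ((M%:R / (2 * (z - w) ^+ 2)) *: W3 (wt z) (-2) (wt w) (-1) (wt w) (-1)
  - (M%:R / (2 * (z - w))) *: (W3 (wt z) (-2) (wmul (wt w) (wt w)) (-1) (wt w) (-1)
     + W3 (wt z) (-2) (wt w) (-1) (wmul (wt w) (wt w)) (-1))).
  rewrite wt_sq [wt w]wt_sum !W3_pairs.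
  rewrite -big_split !scaler_sumr -sumrB; apply: eq_bigr => ij _ /=.
  by lmod_eq C; rewrite ?invfM; ring.
rewrite [W3 _ _ (wt w) _ (wmul _ _) _]W3C23 //.
by lmod_eq C; field; rewrite subr_eq0 zw.
Qed.

Variables (T : V -> V) (Y : V -> int -> V -> V).
Hypothesis TY : is_vertex_structure T Y.
Hypothesis kM : forall i, k i + M%:R != 0.
Hypothesis M0 : M%:R != 0 :> C.

Lemma Y_s1 z v : (forall i, z != zs i) -> Y (s1 zs k I z) 0 v = s1_mode I Y (wt z) v.
Proof. by move=> zz; rewrite s1E. Qed.

Section Points.
Variables (z w : C).
Hypothesis zz : forall i, z != zs i.
Hypothesis ww : forall i, w != zs i.
Hypothesis zw : z != w.
Local Notation p := (wt z).
Local Notation q := (wt w).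

Lemma W2_s1_weight m g n : W2 (s1_weight M k p q (z - w)^-1) m g n
  = - (M%:R / (z - w) ^+ 2) *: (W2 q m g n - W2 p m g n)
    + (z - w)^-1 *: (level q *: W2 p m g n - level p *: W2 q m g n).
Proof.
have L := W2_lin1 k I m g n.
rewrite /s1_weight !(linD L, linZ L, linN L).
by lmod_eq C; rewrite ?exprVn; ring.
Qed.

Lemma W3_s1_weight m g n h l : W3 (s1_weight M k p q (z - w)^-1) m g n h l
  = - (M%:R / (z - w) ^+ 2) *: (W3 q m g n h l - W3 p m g n h l)
    + (z - w)^-1 *: (level q *: W3 p m g n h l - level p *: W3 q m g n h l).
Proof.
have L := W3_lin1 k I m g n h l.
rewrite /s1_weight !(linD L, linZ L, linN L).
by lmod_eq C; rewrite ?exprVn; ring.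
Qed.

Lemma s1_varsigma1 : Y (s1 zs k I z) 0 (varsigma1 zs k I w) =
  - tderive zs 1 (fun w' => A11 zs k I z w') w
  + T (B11 zs k I z w
       + tderive zs 1 (fun z' => (M%:R / (z' - w)) *: varsigma1 zs k I w) z).
Proof.
have pq := wtM zz ww zw; have TL := T_linear TY.
have L1 := W2_lin1 k I; have L2 := W2_lin2 k I.
rewrite Y_s1 // varsigma1E (linZ (s1_mode_linear I TY p)).
rewrite (s1_mode_W2 I_basis I_orth TY kM pq) W2_s1_weight pq.
rewrite (linZ (L1 _ _ _)) (linD (L1 _ _ _)) (linN (L1 _ _ _)).
rewrite (linZ (L2 _ _ _)) (linD (L2 _ _ _)) (linN (L2 _ _ _)).
rewrite /tderive vderive_A11 // vderive_scaled // A11E B11E !twistE.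
rewrite !(linD TL, linN TL, linZ TL) !(T_W2 _ TY).
by lmod_eq C; field; rewrite subr_eq0 zw M0.
Qed.

Lemma s1_varsigma2 : Y (s1 zs k I z) 0 (varsigma2 zs k I w) =
  - tderive zs 2 (fun w' => A12 zs k I z w') w
  + T (B12 zs k I z w
       + tderive zs 1 (fun z' => (M%:R / (z' - w)) *: varsigma2 zs k I w) z).
Proof.
have pq := wtM zz ww zw; have TL := T_linear TY.
have L1 := W3_lin1 k I; have L2 := W3_lin2 k I.
rewrite Y_s1 // varsigma2E (linZ (s1_mode_linear I TY p)).
rewrite (s1_mode_W3 I_basis I_orth TY kM pq) W3_s1_weight pq.
rewrite (linZ (L1 _ _ _ _ _)) (linD (L1 _ _ _ _ _)) (linN (L1 _ _ _ _ _)).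
rewrite (linZ (L2 _ _ _ _ _)) (linD (L2 _ _ _ _ _)) (linN (L2 _ _ _ _ _)).
rewrite /tderive vderive_A12 // vderive_scaled // A12E B12E !twistE.
rewrite !(linD TL, linN TL, linZ TL) !(T_W3 _ TY).
by lmod_eq C; field; rewrite subr_eq0 zw M0.
Qed.
End Points.
End Assembly.

Unset Implicit Arguments.

Theorem theorem3p5 (R : realType) (M : nat) (HM : (3 <= M)%N)
    (N : nat) (HN : (1 <= N)%N)
    (zs : 'I_N -> R[i]) (Hzs : injective zs)
    (k : 'I_N -> R[i]) (Hk : forall i, k i != - M%:R)
    (d : nat) (I : d.-tuple (sl R[i] M)) (HI : basis_of fullv I)
    (Horth : forall a b : 'I_d, trform (tnth I a) (tnth I b) = (a == b)%:R)
    (T : vacuum_module M k -> vacuum_module M k)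
    (Y : vacuum_module M k -> int -> vacuum_module M k -> vacuum_module M k)
    (HTY : is_vertex_structure T Y)
    (z w : R[i]) (Hz : forall i, z != zs i) (Hw : forall i, w != zs i)
    (Hzw : z != w) :
  Y (s1 zs k I z) 0 (varsigma1 zs k I w) =
    - tderive zs 1 (fun w' => A11 zs k I z w') w
    + T (B11 zs k I z w
         + tderive zs 1
             (fun z' => (M%:R / (z' - w)) *: varsigma1 zs k I w) z)
  /\
  Y (s1 zs k I z) 0 (varsigma2 zs k I w) =
    - tderive zs 2 (fun w' => A12 zs k I z w') w
    + T (B12 zs k I z w
         + tderive zs 1
             (fun z' => (M%:R / (z' - w)) *: varsigma2 zs k I w) z).
Proof.
have M0 : M%:R != 0 :> R[i] by rewrite pnatr_eq0 -lt0n (leq_trans _ HM).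
have kM i : k i + M%:R != 0 by rewrite addr_eq0.
split.
- exact: (@s1_varsigma1 _ M N zs k d I HI Horth T Y HTY kM M0 z w Hz Hw Hzw).
- exact: (@s1_varsigma2 _ M N zs k d I HI Horth T Y HTY kM M0 z w Hz Hw Hzw).
Qed.
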